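(* Let $n\ge1$ and let $\lambda$ be a partition of $n$. Set $\chi_{\mathrm{hook}}=\sum_{k=0}^{n-1}[n-k,1^k]$ and let $[\lambda]^{(2)}$ be the class function $g\mapsto[\lambda](g^2)$ on $S_n$. Then $$\langle[\lambda]^{(2)},\chi_{\mathrm{hook}}\rangle=\begin{cases}1&\text{if }\lambda\text{ is a hook},\\0&\text{otherwise,}\end{cases}$$ or equivalently, $$\sum_{k=0}^{n-1}sg(\lambda,(n-k,1^k))-\sum_{k=0}^{n-1}ag(\lambda,(n-k,1^k))=\begin{cases}1&\text{if }\lambda\text{ is a hook},\\0&\text{otherwise.}\end{cases}$$ In particular, when $\lambda$ is not a hook, $A^2([\lambda])$ has a constituent $[n-k,1^k]$ for some $0\le k\le n-1$.
   Context: For a partition $\lambda$ of $n$, $[\lambda]$ denotes the irreducible complex character of the symmetric group $S_n$ labelled by $\lambda$; $\langle\cdot,\cdot\rangle$ is the usual scalar product of class functions. For a character $\chi$ of a finite group, $S^2(\chi)(g)=\tfrac12(\chi(g)^2+\chi(g^2))$ and $A^2(\chi)(g)=\tfrac12(\chi(g)^2-\chi(g^2))$, and $S^2([\lambda])=\sum_\mu sg(\lambda,\mu)[\mu]$, $A^2([\lambda])=\sum_\mu ag(\lambda,\mu)[\mu]$. A partition of $n$ is a hook if it has the form $(n-k,1^k)$ with $0\le k\le n-1$. *)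

(* Defs.v *)
From HB Require Import structures.
From mathcomp Require Import all_boot all_order all_algebra all_fingroup.
From mathcomp Require Import all_solvable all_field all_character.

Set Implicit Arguments.
Unset Strict Implicit.
Unset Printing Implicit Defensive.

Import Order.TTheory GRing.Theory Num.Theory.
Local Open Scope ring_scope.

Section PowerCharacters.

Variables (gT : finGroupType) (G : {group gT}).
Implicit Type phi : 'CF(G).

(* A class function vanishes outside of G, whence the indicator of G. *)
Fact cfSquareArg_subproof phi :
  is_class_fun <<G>>%g [ffun g => phi (g ^+ 2)%g *+ (g \in G)].
Proof.
rewrite genGid; apply: intro_class_fun => [x y Gx Gy | x /negbTE-> //].
by rewrite groupJr // -conjXg cfunJ.
Qed.

(* The class function phi^(2) : g |-> phi (g ^+ 2). *)
Definition cfSquareArg phi : 'CF(G) := Cfun 0 (cfSquareArg_subproof phi).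

Lemma cfSquareArgE phi g : g \in G -> cfSquareArg phi g = phi (g ^+ 2)%g.
Proof. by move=> Gg; rewrite cfunE Gg. Qed.

Definition cfSym2 phi : 'CF(G) := 2%:R^-1 *: (phi ^+ 2 + cfSquareArg phi).

Definition cfAlt2 phi : 'CF(G) := 2%:R^-1 *: (phi ^+ 2 - cfSquareArg phi).

Lemma cfSym2E phi g :
  g \in G -> cfSym2 phi g = (phi g ^+ 2 + phi (g ^+ 2)%g) / 2%:R.
Proof. by move=> Gg; rewrite !cfunE Gg mulr1n mulrC -expr2. Qed.

Lemma cfAlt2E phi g :
  g \in G -> cfAlt2 phi g = (phi g ^+ 2 - phi (g ^+ 2)%g) / 2%:R.
Proof. by move=> Gg; rewrite !cfunE Gg mulr1n mulrC -expr2. Qed.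

End PowerCharacters.

Definition is_intpart (n : nat) (la : seq nat) : bool :=
  [&& sorted geq la, 0%N \notin la & sumn la == n].

Definition hook_part (n k : nat) : seq nat := (n - k)%N :: nseq k 1%N.

Definition is_hook (n : nat) (la : seq nat) : bool :=
  [exists k : 'I_n, la == hook_part n k].

Section Specht.

Variables (n : nat) (la : seq nat).

(* The boxes of the Young diagram of la are numbered 0, ..., n - 1 in reading *)
(* order, so that the box i lies in row [reshape_index la i] and in column    *)
(* [reshape_offset la i].                                                     *)
Definition row_stab : {set 'S_n} :=
  [set s : 'S_n |
    [forall i : 'I_n, reshape_index la (s i) == reshape_index la i]].

Definition col_stab : {set 'S_n} :=
  [set s : 'S_n |
    [forall i : 'I_n, reshape_offset la (s i) == reshape_offset la i]].

Local Notation aG := (regular_repr algC [set: 'S_n]).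

(* The Young symmetrizer \sum_(p in row_stab) \sum_(q in col_stab) sgn(q) p q *)
(* as an element of the group algebra, i.e., of the regular representation.   *)
Definition young_symmetrizer : 'rV[algC]_#|[set: 'S_n]| :=
  gring_row (\sum_(p in row_stab) \sum_(q in col_stab)
               (-1) ^+ odd_perm q *: aG (p * q)%g).

Definition specht_repr :=
  submod_repr (cyclic_mx_module aG young_symmetrizer).

(* The character [la], when la is a partition of n: the one afforded by the   *)
(* right ideal of the group algebra generated by the Young symmetrizer.       *)
Definition specht_char : 'CF([set: 'S_n]) := cfRepr specht_repr.

End Specht.

Definition hook_char (n : nat) : 'CF([set: 'S_n]) :=
  \sum_(k < n) specht_char n (hook_part n k).

(* Multiplicities of [mu] in S^2([la]) and in A^2([la]). *)
Definition sg (n : nat) (la mu : seq nat) : algC :=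
  '[cfSym2 (specht_char n la), specht_char n mu].

Definition ag (n : nat) (la mu : seq nat) : algC :=
  '[cfAlt2 (specht_char n la), specht_char n mu].

(* Main.v *)
From HB Require Import structures.
Require Import Defs.
From mathcomp Require Import all_boot all_order all_algebra all_fingroup.
From mathcomp Require Import all_solvable all_field all_character.
From mathcomp Require Import ring zify.

Set Implicit Arguments.
Unset Strict Implicit.
Unset Printing Implicit Defensive.

Import Order.TTheory GRing.Theory Num.Theory.
Local Open Scope ring_scope.

(** The hook characters are the exterior powers of the reflection module, so
    their sum h is half the character of the exterior algebra of the
    permutation module: 2 h(g) is the sum, over the g-stable sets B, of the
    sign of g on B ([hook_charE]; g and its inverse have the same stable sets
    and signs). If g has even order, toggling a cycle of even length in B
    reverses this sign and h(g) = 0 ([stable_sum_even]). If g has odd order,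
    all the signs are 1 and 2 h(g) is the number of g-stable sets; these are
    also the sets stable under g ^ 2, which generates the same group, so that
    h(g ^ 2) = h(g) ([stable_sum_square]). As squaring permutes the elements
    of odd order, the scalar product of g |-> phi(g ^ 2) with h is that of phi
    with h, for every class function phi ([cfdot_square_hook]). For phi = [la]
    it is 1 or 0, because the Specht characters are irreducible and pairwise
    distinct. The second formula of the theorem is the same one, since S^2 -
    A^2 is the square-argument character. Finally h >= 0, h(1) > 0 and [la] is
    real, hence S^2 + A^2 = [la]^2 has a positive scalar product with h; if la
    is not a hook the S^2 and A^2 parts of it are equal, so that the A^2 part
    is not zero.

    Two facts on Specht characters carry this. They are studied through class
    traces in the group algebra: if E ^ 2 = c E, the character of the right
    ideal of E is, up to the factor |G| c, the trace of E against a class sum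
    ([cyclic_char_idem]).

    Irreducibility and distinctness follow from Young's dichotomy
    ([row_gr_col]): for the row symmetrizer a of la and the column
    antisymmetrizer b of mu, the element a x b is 0, or la = mu and it is a
    multiple of a b, as soon as the column indices of the boxes of la have at
    least as large a sum as those of mu. The combinatorial input is an
    inequality in the opposite direction when x never sends two boxes in a row
    of la to a column of mu ([offset_sum_defect]).

    The exterior powers of the permutation module are generated by elements
    f_k, the product of a symmetrizer of n - k points by an antisymmetrizer of
    the k others. Expanding the symmetrizers of a hook over its corner
    expresses the class traces of two consecutive hooks through those of f_k
    and of f_k times a transposition ([hook_elt_col], [hook_elt_row]). With
    the value of c for hooks ([hook_square]) this gives the Pieri rule
    [hook_pieri], by which the k-th exterior power is the sum of the hooks k
    and k - 1. *)

(** * The group algebra and characters of quasi-idempotents *)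

Section GroupAlgebra.

Variable gT : finGroupType.
Local Notation G := [set: gT].
Local Notation gr := (regular_repr algC G).
Implicit Types (x y g : gT) (M E F : 'M[algC]_#|G|).

Lemma grM x y : gr (x * y)%g = gr x *m gr y.
Proof. by rewrite repr_mxM ?inE. Qed.

Lemma gr1 : gr 1%g = 1%:M.
Proof. exact: repr_mx1. Qed.

Lemma tr_gr x : \tr (gr x) = #|G|%:R *+ (x == 1%g).
Proof.
by have /cfunP/(_ x) := cfReprReg [group of G]; rewrite cfRegE cfunE inE.
Qed.

Definition gsum (a : gT -> algC) := \sum_x a x *: gr x.

Lemma tr_gsum a y : \tr (gsum a *m gr y^-1%g) = #|G|%:R * a y.
Proof.
rewrite /gsum mulmx_suml linear_sum (bigD1 y) //= big1 => [|x neq_xy].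
  by rewrite -scalemxAl -grM mulgV linearZ /= tr_gr eqxx addr0 mulrC.
by rewrite -scalemxAl -grM linearZ /= tr_gr -eq_mulgV1 (negPf neq_xy) mulr0.
Qed.

Definition class_sum g := \sum_x gr (g ^ x)%g.

Lemma class_sum_comm g y : gr y *m class_sum g = class_sum g *m gr y.
Proof.
rewrite /class_sum mulmx_sumr mulmx_suml.
rewrite [RHS](reindex_inj (mulIg y^-1%g)) /=.
apply: eq_bigr => x _; rewrite -!grM; congr (gr _).
by rewrite conjgM /conjg invgK !mulgA mulgKV.
Qed.

(** Up to a factor |G|, the value at g of the character of the one-sided
    ideal generated by an idempotent of the group algebra; as a function of
    that idempotent it is linear and invariant under cyclic permutation. *)
Definition class_trace g := mxtrace \o mulmxr (class_sum g).
HB.instance Definition _ g := GRing.Linear.on (class_trace g).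

Lemma class_traceE g M : class_trace g M = \sum_x \tr (M *m gr (g ^ x)%g).
Proof. by rewrite /class_trace /= mulmx_sumr linear_sum. Qed.

(** A trace against a central element does not see the order of a product. *)
Lemma class_traceC g y M :
  class_trace g (gr y *m M) = class_trace g (M *m gr y).
Proof.
rewrite /class_trace /= -mulmxA mxtrace_mulC -mulmxA -class_sum_comm.
by rewrite mulmxA.
Qed.

Lemma class_traceJ g y M :
  class_trace g (gr y^-1%g *m M *m gr y) = class_trace g M.
Proof. by rewrite -mulmxA class_traceC -mulmxA -grM mulgV gr1 mulmx1. Qed.

(** The matrix of u |-> x u on the group algebra: it commutes with the right
    action [gr], and projections onto right ideals are combinations of it. *)
Definition left_mul_mx x : 'M[algC]_#|G| :=
  \matrix_i delta_mx 0 (gring_index [group of G] (x * enum_val i)%g).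

Local Notation idx := (gring_index [group of G]).

Lemma idxK x : enum_val (idx x) = x.
Proof. by rewrite gring_indexK ?inE. Qed.

Lemma gring_row_gr x : gring_row (gr x) = delta_mx 0 (idx x).
Proof. by rewrite /gring_row rowK idxK mul1g. Qed.

Lemma gring_row_left x y :
  gring_row (gr y) *m left_mul_mx x = gring_row (gr (x * y)%g).
Proof. by rewrite !gring_row_gr -rowE rowK idxK. Qed.

(** Both sides count, up to the factor |G|, the fixed points u = x u g. *)
Lemma tr_left_mul x g :
  #|G|%:R * \tr (left_mul_mx x *m gr g) = class_trace g (gr x).
Proof.
rewrite class_traceE (reindex_inj invg_inj) /= {1}/mxtrace.
rewrite (reindex (fun y => idx y)) /=; last first.
  exists enum_val => [y _ | i _]; [exact: idxK | exact: gring_valK].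
rewrite mulr_sumr; apply: eq_bigr => y _.
have -> : (left_mul_mx x *m gr g) (idx y) (idx y) = (x * y * g == y)%g%:R.
  transitivity ((row (idx y) (left_mul_mx x *m gr g)) 0 (idx y)).
    by rewrite !mxE.
  rewrite row_mul rowK idxK -gring_row_gr -gring_row_mul -grM gring_row_gr.
  by rewrite mxE eqxx -(inj_eq (can_inj idxK)) eq_sym.
rewrite -grM tr_gr -[RHS]mulr_natr; congr (_ * (_ : bool)%:R).
by rewrite conjgE invgK !mulgA -eq_mulgV1.
Qed.

(** P factors as Q B, with B a basis of U, so that B Q = 1 because P is the
    identity on U; the trace on U is that of B (rG g) Q. *)
Lemma submod_trace_proj n (rG : mx_representation algC G n) (U P : 'M_n)
    (modU : mxmodule rG U) g :
  (P <= U)%MS -> U *m P = U -> \tr (submod_repr modU g) = \tr (P *m rG g).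
Proof.
move=> sPU UP; set B := val_submod (U := U) 1%:M.
have BP : B *m P = B.
  have: (B <= U)%MS by exact: val_submodP.
  by case/submxP=> D ->; rewrite -mulmxA UP.
rewrite -(in_submodK sPU) val_submodE -/B -mulmxA [RHS]mxtrace_mulC.
have: val_submod (1%:M *m submod_mx modU g) = B *m rG g.
  by rewrite val_submodJ ?inE.
rewrite mul1mx val_submodE -/B => <-.
have BI : B *m in_submod U P = 1%:M.
  apply: (can_inj (val_submodK (U := U))).
  by rewrite val_submodE -/B -mulmxA /B -val_submodE in_submodK.
by rewrite -mulmxA BI mulmx1.
Qed.

(** The character of the right ideal generated by E. *)
Definition cyclic_char E : 'CF(G) :=
  cfRepr (submod_repr (cyclic_mx_module gr (gring_row E))).

(** When E ^ 2 = c E, left multiplication by c^-1 E is an equivariant projection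
    onto the right ideal of E, whose character is therefore the trace of
    u |-> c^-1 E u g. *)
Lemma cyclic_char_idem (a : gT -> algC) (c : algC) (E := gsum a) g :
  c != 0 -> E *m E = c *: E ->
  #|G|%:R * c * cyclic_char E g
    = class_trace g E.
Proof.
move=> nz_c EE.
pose L := \sum_x a x *: left_mul_mx x.
have rowL y : gring_row (gr y) *m L = gring_row (E *m gr y).
  rewrite /L /E /gsum mulmx_suml mulmx_sumr linear_sum.
  by apply: eq_bigr => x _;
    rewrite -scalemxAr gring_row_left -scalemxAl -grM linearZ.
have EL y : gring_row (E *m gr y) *m L = c *: gring_row (E *m gr y).
  have Ey: E *m gr y = \sum_x a x *: gr (x * y)%g.
    by rewrite mulmx_suml; apply: eq_bigr => x _; rewrite -scalemxAl -grM.
  clearbody L E; rewrite -linearZ scalemxAl -EE -mulmxA Ey mulmx_sumr.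
  rewrite linear_sum mulmx_suml linear_sum.
  by apply: eq_bigr => x _;
    rewrite -scalemxAr linearZ -scalemxAl rowL /= linearZ.
rewrite /cyclic_char; set U := cyclic_mx _ _.
have sLU : (c^-1 *: L <= U)%MS.
  rewrite scalemx_sub //; apply/row_subP=> i.
  rewrite -(gring_valK (G := [group of G]) i) rowE -gring_row_gr rowL.
  rewrite gring_row_mul; apply/cyclic_mxP; exists (gr (enum_val i)) => //.
  by rewrite envelop_mx_id ?inE.
have UL : U *m (c^-1 *: L) = U.
  apply/row_matrixP=> i; rewrite row_mul.
  have /cyclic_mxP[A EA ->] := row_sub i U.
  have [b ->] := envelop_mxP EA.
  rewrite mulmx_sumr mulmx_suml; apply: eq_bigr => x _.
  rewrite -!scalemxAr -gring_row_mul -scalemxAl EL 2!scalerA mulrAC.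
  by rewrite mulVf // mul1r.
rewrite cfunE inE mulr1n (submod_trace_proj _ g sLU UL) -scalemxAl linearZ /=.
rewrite -mulrA mulVKf // /L mulmx_suml linear_sum mulr_sumr /E /gsum linear_sum.
apply: eq_bigr => x _.
by rewrite -scalemxAl !linearZ /= mulrCA tr_left_mul.
Qed.

End GroupAlgebra.

Section InnerProduct.

Variable gT : finGroupType.
Local Notation G := [set: gT].
Local Notation gr := (regular_repr algC G).
Local Notation N := (#|G|%:R : algC).
Implicit Types (x y g : gT) (M E F : 'M[algC]_#|G|).

Lemma natr_cardT_neq0 : N != 0.
Proof. by rewrite pnatr_eq0 -lt0n cardG_gt0. Qed.

Lemma class_sumJ g x : class_sum (g ^ x)%g = class_sum g.
Proof.
rewrite /class_sum [RHS](reindex_inj (mulgI x)) /=.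
by apply: eq_bigr => y _; rewrite conjgM.
Qed.

Lemma cfdotTE (phi psi : 'CF(G)) :
  '[phi, psi] = N^-1 * \sum_x phi x * (psi x)^*.
Proof. by rewrite cfdotE (eq_bigl xpredT) // => x; rewrite inE. Qed.

(** In the average over g of the product of two class traces, Fourier inversion
    ([tr_gsum]) rebuilds E from its traces; what is left is an average of
    conjugates of E paired with F. *)
Lemma cfdot_cyclic_char a b (c d : algC) (E := gsum a) (F := gsum b) :
  c != 0 -> d != 0 -> E *m E = c *: E -> F *m F = d *: F ->
  N * c * d * '[cyclic_char E, cyclic_char F]
    = \sum_u \tr (F *m (gr u^-1%g *m E *m gr u)).
Proof.
move=> nz_c nz_d EE FF; set chiE := cyclic_char E; set chiF := cyclic_char F.
have chE g : N * c * chiE g = class_trace g E by exact: cyclic_char_idem.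
have chF g : N * d * chiF g = class_trace g F by exact: cyclic_char_idem.
have chFV g : (chiF g)^* = chiF g^-1%g by rewrite char_inv ?cfRepr_char.
have nz_N := natr_cardT_neq0.
clearbody chiE chiF.
apply: (mulfI (mulf_neq0 natr_cardT_neq0 natr_cardT_neq0)).
transitivity (\sum_g class_trace g E * class_trace g^-1%g F).
  rewrite cfdotTE; under eq_bigr do rewrite chFV.
  under [in RHS]eq_bigr do rewrite -chE -chF.
  rewrite [in RHS](eq_bigr (fun g => N * c * (N * d) * (chiE g * chiF g^-1%g))).
    rewrite -mulr_sumr; move: (\sum_g _) => S.
    by field.
  by move=> g _; ring.
(* The class sum of g^-1 is also that of the inverse of any conjugate of g, *)
(* so that the sum over conjugates of g reduces to |G| times one term.      *)
transitivity (\sum_g \sum_u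
    \tr (E *m gr (g ^ u)%g) * class_trace (g ^ u)^-1%g F).
  apply: eq_bigr => g _; rewrite class_traceE mulr_suml.
  by apply: eq_bigr => u _; rewrite -conjVg /class_trace /= class_sumJ.
transitivity (N * \sum_g \tr (E *m gr g^-1%g) * class_trace g F).
  rewrite exchange_big /=.
  rewrite [RHS]mulr_natl -[#|G| in RHS]sum1_card -sumrMnr.
  apply: eq_big => [u|u _]; first by rewrite inE.
  rewrite mulr1n [RHS](reindex_inj invg_inj) /=.
  rewrite [RHS](reindex_inj (conjg_inj u)).
  by apply: eq_bigr => g _; rewrite invgK.
rewrite -mulrA; congr (_ * _).
transitivity
    (\sum_g \sum_u N * \tr (F *m (gr u^-1%g *m (a g *: gr g) *m gr u))).
  apply: eq_bigr => g _; rewrite tr_gsum class_traceE mulr_sumr.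
  apply: eq_bigr => u _; rewrite -scalemxAr -scalemxAl -scalemxAr linearZ /=.
  by rewrite -!grM conjgE mulgA mulrA.
rewrite exchange_big mulr_sumr; apply: eq_bigr => u _.
by rewrite -mulr_sumr /E /gsum mulmx_sumr mulmx_suml mulmx_sumr linear_sum.
Qed.

(** The elements E u F span the homomorphisms between the two ideals. *)
Lemma cyclic_char_orthogonal a b (c d : algC) (E := gsum a) (F := gsum b) :
    c != 0 -> d != 0 -> E *m E = c *: E -> F *m F = d *: F ->
    (forall u, E *m gr u *m F = 0) ->
  '[cyclic_char E, cyclic_char F] = 0.
Proof.
move=> nz_c nz_d EE FF EF;
  apply: (mulfI (mulf_neq0 (mulf_neq0 natr_cardT_neq0 nz_c) nz_d)).
rewrite cfdot_cyclic_char // mulr0 big1 // => u _.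
by rewrite mxtrace_mulC -!mulmxA (mulmxA E) EF mulmx0 mxtrace0.
Qed.

(** With A = C R a full-rank factorization, A ^ 2 = 0 gives R C = 0, and
    A and R C have the same trace. *)
Lemma nilpotent_trace0 m (A : 'M[algC]_m) : A *m A = 0 -> \tr A = 0.
Proof.
move=> AA0; rewrite -(mulmx_base A) mxtrace_mulC.
suff ->: row_base A *m col_base A = 0 by rewrite mxtrace0.
apply: (row_free_inj (row_base_free A));
  apply: (row_full_inj (col_base_full A)).
by rewrite mul0mx mulmx0 -mulmxA mulmx_base mulmxA mulmx_base.
Qed.

(** A quasi-idempotent of nonzero trace is not nilpotent. *)
Lemma quasi_idem_scalar_neq0 E (c : algC) : E *m E = c *: E -> \tr E != 0 ->
  c != 0.
Proof.
move=> EE; apply: contraNneq => c0.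
by rewrite nilpotent_trace0 // EE c0 scale0r.
Qed.

Lemma tr_mul_gsum a E F :
  \tr (E *m gsum a *m F) = \sum_u a u * \tr (E *m gr u *m F).
Proof.
rewrite /gsum mulmx_sumr mulmx_suml linear_sum.
by apply: eq_bigr => u _; rewrite -scalemxAr -scalemxAl linearZ.
Qed.

(** If E A E is a line, where A is the group algebra, then so is the
    endomorphism ring of the ideal E A. The norm is computed by trading
    tr (E u^-1 E), which is |G| k(u^-1), for the coefficients of E until the
    trace of E ^ 3 = c ^ 2 E appears. *)
Lemma cyclic_char_norm1 a (c : algC) (k : gT -> algC) (E := gsum a) :
    E *m E = c *: E -> \tr E = N -> (forall u, E *m gr u *m E = k u *: E) ->
  '[cyclic_char E] = 1.
Proof.
move=> EE trE EuE; have nz_N := natr_cardT_neq0.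
have nz_c: c != 0 by apply: quasi_idem_scalar_neq0 EE _; rewrite trE.
apply: (mulfI (mulf_neq0 (mulf_neq0 nz_N nz_c) nz_c)).
rewrite cfdot_cyclic_char // mulr1.
transitivity (\sum_u a u * \tr (E *m gr u *m E)); last first.
  transitivity (\tr (E *m E *m E)).
    by rewrite {2}/E tr_mul_gsum.
  by rewrite EE -scalemxAl EE !linearZ /= trE mulrA mulrC mulrA.
rewrite (reindex_inj invg_inj); apply: eq_bigr => u _ /=.
rewrite invgK !mulmxA !EuE -scalemxAl !linearZ /= trE tr_gsum.
by ring.
Qed.

End InnerProduct.

(** * Pairs of tableaux without a common row-column pair *)

Section TableauCombinatorics.
Local Open Scope nat_scope.

Lemma flatten_index_lt (sh : seq nat) r c :
  c < nth 0 sh r -> flatten_index sh r c < sumn sh.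
Proof.
rewrite /flatten_index; elim: sh r => [|a sh IH] [|r] //= lt_c.
  by rewrite add0n; lia.
by have := IH r lt_c; lia.
Qed.

Lemma reshape_inj (la : seq nat) i j :
  reshape_index la i = reshape_index la j ->
  reshape_offset la i = reshape_offset la j -> i = j.
Proof. by move=> er ec; rewrite -(reshape_indexK la i) er ec reshape_indexK.
Qed.

Lemma reshape_offset_cons a la i :
  reshape_offset (a :: la) i = if i < a then i else reshape_offset la (i - a).
Proof.
rewrite /reshape_offset /reshape_index /= subn_eq0.
case: ltnP => [|le_ai] /=; first by rewrite subn0.
by rewrite subnDA subSn.
Qed.

(** A row of length a meets the column c exactly when c < a. *)
Lemma count_offset (la : seq nat) c :
  \sum_(0 <= i < sumn la) (reshape_offset la i == c) = count (ltn c) la.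
Proof.
elim: la => [|a la IH] /=; first by rewrite big_geq.
rewrite (big_cat_nat (n := a)) ?leq_addr //= -IH; congr (_ + _).
  rewrite (eq_big_nat _ _ (F2 := fun i => (i == c) : nat)); last first.
    by move=> i /andP[_ lt_ia]; rewrite reshape_offset_cons lt_ia.
  have [lt_ca | le_ac] := ltnP c a.
    rewrite (bigD1_seq c) ?iota_uniq ?mem_index_iota //= eqxx big1 // => i.
    by move/negPf->.
  rewrite big1_seq // => i /andP[_]; rewrite mem_index_iota => /andP[_ lt_ia].
  by case: eqP => // eq_ic; lia.
rewrite -{1}[a]add0n big_addn addKn; apply: eq_bigr => i _.
by rewrite reshape_offset_cons ltnNge leq_addl addnK.
Qed.

(** Here [count (ltn c) la] is the length of the column c. *)
Lemma eq_intpart n (la mu : seq nat) :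
    is_intpart n la -> is_intpart n mu ->
    (forall c, count (ltn c) la = count (ltn c) mu) -> la = mu.
Proof.
case/and3P=> la_s la_0 _ /and3P[mu_s mu_0 _] eq_ct.
have tr: transitive geq by move=> x y z /= le1 le2; apply: leq_trans le2 le1.
apply: (sorted_eq tr) => //; first by move=> x y /=; lia.
apply/allP=> /= c _; apply/eqP; case: c => [|c].
  by rewrite (count_memPn la_0) (count_memPn mu_0).
have ctE (s : seq nat) : count_mem c.+1 s + count (ltn c.+1) s =
  count (ltn c) s.
  elim: s => //= a s <-; case: (ltngtP c.+1 a); lia.
apply: (@addIn (count (ltn c.+1) mu)); rewrite -{1}eq_ct.
by apply: etrans (ctE la) _; rewrite eq_ct; apply: esym (ctE mu).
Qed.

Variables (n : nat) (la mu : seq nat).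
Hypotheses (laP : is_intpart n la) (muP : is_intpart n mu).
Variable x : 'S_n.
Local Notation r i := (reshape_index la i).
Local Notation cl i := (reshape_offset la i).
Local Notation cm i := (reshape_offset mu i).

Hypothesis indep : forall i j : 'I_n,
  r i = r j -> cm (x i) = cm (x j) -> i = j.

Let sum_la : sumn la = n. Proof. by case/and3P: laP => _ _ /eqP. Qed.
Let sum_mu : sumn mu = n. Proof. by case/and3P: muP => _ _ /eqP. Qed.

(* The box i of la and the box x i of mu are combined into the point          *)
(* (r i, cm (x i)). The set X collects the i for which this point falls       *)
(* outside of the diagram of la; otherwise phi i is the box of la there (the  *)
(* default value i of insubd is only taken on X).                             *)
Let L (i : 'I_n) := nth 0 la (r i).
Let X := [set i : 'I_n | L i <= cm (x i)].
Let phi (i : 'I_n) : 'I_n := insubd i (flatten_index la (r i) (cm (x i))).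

Let phiP i : i \notin X -> r (phi i) = r i /\ cl (phi i) = cm (x i).
Proof.
rewrite inE -ltnNge => lt_cL.
rewrite val_insubd -[X in _ < X]sum_la flatten_index_lt //.
by rewrite flatten_indexKl // flatten_indexKr.
Qed.

Let phi_inj : {in ~: X &, injective phi}.
Proof.
move=> i j; rewrite !in_setC => /phiP[ri ci] /phiP[rj cj] eq_phi.
by apply: indep; rewrite -?ri -?rj -?ci -?cj eq_phi.
Qed.

Let Y := phi @: ~: X.

Let sumY (F : 'I_n -> nat) : \sum_(i in ~: X) F (phi i) = \sum_(j in Y) F j.
Proof. by rewrite /Y big_imset. Qed.

Let cardY : #|~: Y| = #|X|.
Proof.
have := cardsC X; have := cardsC Y; rewrite card_in_imset //; lia.
Qed.

Let split_sum (A : {set 'I_n}) (F : 'I_n -> nat) :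
  \sum_i F i = \sum_(i in A) F i + \sum_(i in ~: A) F i.
Proof.
rewrite (bigID (mem A)) /=; congr (_ + _).
by apply: eq_bigl => i; rewrite inE.
Qed.

(** Boxes of la are pairwise distinct, and so are the points (r i, cm (x i)).
    Each row holds as many boxes as points; a point outside of the diagram has
    a column at least the row length, and the box it misses a smaller one. *)
Lemma offset_sum_defect : \sum_(i < n) cl i + #|X| <= \sum_(i < n) cm i.
Proof.
rewrite [X in _ <= X](reindex_inj (@perm_inj _ x)) /=.
rewrite (split_sum X (fun i => cm (x i))) (split_sum Y (fun i => cl i)).
have -> : \sum_(i in ~: X) cm (x i) = \sum_(j in Y) cl j.
  rewrite -sumY; apply: eq_bigr => i; rewrite in_setC => /phiP[_ ->] //.
have leX : \sum_(i in X) L i <= \sum_(i in X) cm (x i).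
  by apply: leq_sum => i; rewrite inE.
have leY : \sum_(j in ~: Y) cl j + #|X| <= \sum_(j in ~: Y) L j.
  rewrite -cardY -sum1_card -big_split /=; apply: leq_sum => j _.
  by rewrite addn1 reshape_offsetP // sum_la.
have eqL : \sum_(i in X) L i = \sum_(j in ~: Y) L j.
  have eqY : \sum_(j in Y) L j = \sum_(i in ~: X) L i.
    by rewrite -sumY; apply: eq_bigr => i; rewrite in_setC /L => /phiP[->].
  by have := split_sum X L; rewrite (split_sum Y L) eqY addnC => /addIn.
by rewrite -addnA addnC leq_add2r (leq_trans leY) // -eqL.
Qed.

Hypothesis le_sum : \sum_(i < n) cm i <= \sum_(i < n) cl i.

Let X0 : X = set0.
Proof. by apply/eqP; rewrite -cards_eq0; have := offset_sum_defect; lia. Qed.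

Let phi_injT : injective phi.
Proof. by move=> i j; apply: phi_inj; rewrite X0 !inE. Qed.

Let phiE i : r (phi i) = r i /\ cl (phi i) = cm (x i).
Proof. by apply: phiP; rewrite X0 inE. Qed.

(** At equality phi is a bijection that matches the columns of la with those of
    mu, hence the column lengths agree. *)
Lemma indep_shape_eq : la = mu.
Proof.
apply: (eq_intpart laP muP) => c;
  rewrite -!count_offset sum_la sum_mu !big_mkord.
rewrite (reindex_inj phi_injT) [RHS](reindex_inj (@perm_inj _ x)) /=.
by apply: eq_bigr => i _; have [_ ->] := phiE i.
Qed.

Lemma indep_perm : exists2 p, p \in row_stab n la &
  forall i, cl (p i) = cm (x i).
Proof.
exists (perm phi_injT) => [|i]; last by rewrite permE; have [] := phiE i.
by rewrite inE; apply/forallP=> i; rewrite permE; have [-> _] := phiE i.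
Qed.

End TableauCombinatorics.

(** * Row and column sums, and the irreducibility of Specht characters *)

Section SignedSums.

Variable T : finType.
Local Notation ST := {perm T}.
Local Notation gr := (regular_repr algC [set: ST]).
Local Notation N := (#|[set: ST]|%:R : algC).
Implicit Types (P Q : {group ST}) (A B : {set ST}) (t x : ST).

Definition row_sum A := \sum_(p in A) gr p.
Definition sgn_sum B := \sum_(q in B) (-1) ^+ odd_perm q *: gr q.

Lemma row_sum_mulr P t : t \in P -> row_sum P *m gr t = row_sum P.
Proof.
move=> Pt; rewrite /row_sum mulmx_suml [RHS](reindex_inj (mulIg t)) /=.
by apply: eq_big => [p | p _]; rewrite ?groupMr // -grM.
Qed.

Lemma sgn_sum_mull Q t :
  t \in Q -> gr t *m sgn_sum Q = (-1) ^+ odd_perm t *: sgn_sum Q.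
Proof.
move=> Qt; rewrite /sgn_sum mulmx_sumr scaler_sumr.
rewrite [RHS](reindex_inj (mulgI t)) /=.
apply: eq_big => [p | p _]; rewrite ?groupMl // scalerA -scalemxAr -grM.
by rewrite odd_permM signr_addb mulrA -signr_addb addbb mul1r.
Qed.

(** With t a transposition, a x b = a t x b = a x t^x b = - a x b. *)
Lemma row_gr_sgn_eq0 P Q x t : t \in P -> (t ^ x)%g \in Q -> odd_perm t ->
  row_sum P *m gr x *m sgn_sum Q = 0.
Proof.
move=> Pt Qt odd_t; set M := _ *m _; suff MN : M = - M.
  have: 2%:R *: M = 0 by rewrite scaler_nat mulr2n {1}MN addNr.
  by move/eqP; rewrite scaler_eq0 pnatr_eq0 => /eqP.
rewrite {1}/M -(row_sum_mulr Pt) -[_ *m gr x]mulmxA -grM conjgC grM.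
rewrite -!mulmxA sgn_sum_mull // odd_permJ odd_t expr1 scaleN1r.
by rewrite !mulmxN mulmxA.
Qed.

Definition young_coef A B x : algC :=
  \sum_(p in A) \sum_(q in B) (-1) ^+ odd_perm q *+ (x == p * q)%g.

Lemma young_sum2 A B : row_sum A *m sgn_sum B =
  \sum_(p in A) \sum_(q in B) (-1) ^+ odd_perm q *: gr (p * q)%g.
Proof.
rewrite /row_sum mulmx_suml; apply: eq_bigr => p _.
by rewrite /sgn_sum mulmx_sumr; apply: eq_bigr => q _; rewrite -scalemxAr grM.
Qed.

Lemma young_gsum A B : row_sum A *m sgn_sum B = gsum (young_coef A B).
Proof.
rewrite young_sum2 /gsum.
under [RHS]eq_bigr do rewrite /young_coef scaler_suml.
rewrite [RHS]exchange_big; apply: eq_bigr => p _ /=.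
under [RHS]eq_bigr do rewrite scaler_suml.
rewrite [RHS]exchange_big; apply: eq_bigr => q _ /=.
rewrite (bigD1 (p * q)%g) //= eqxx mulr1n big1 ?addr0 // => x /negPf->.
by rewrite mulr0n scale0r.
Qed.

(** The coefficients are integers; this is what makes Specht characters real. *)
Lemma young_coef_real A B x : young_coef A B x \is Num.real.
Proof.
apply: rpred_sum => p _; apply: rpred_sum => q _.
by rewrite rpredMn // rpredX // rpredN rpred1.
Qed.

(** Only the identity contributes to the trace, and p q = 1 forces p = q = 1. *)
Lemma tr_young P Q : P :&: Q = 1%g -> \tr (row_sum P *m sgn_sum Q) = N.
Proof.
move=> PQ1; rewrite young_sum2 linear_sum (bigD1 1%g) //= [X in _ + X]big1.
  rewrite addr0 linear_sum (bigD1 1%g) //= odd_perm1 expr0 scale1r mulg1 tr_gr.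
  rewrite eqxx mulr1n big1 ?addr0 // => q /andP[_ /negPf q1].
  by rewrite linearZ /= mul1g tr_gr q1 mulr0.
move=> p /andP[Pp p1]; rewrite linear_sum big1 // => q Qq.
rewrite linearZ /= tr_gr; case: eqP => [pq1 | _]; last by rewrite mulr0.
case/negP: p1; rewrite -in_set1 -[[set _]]PQ1 inE Pp.
by rewrite -(groupMr p Qq) pq1 group1.
Qed.

(** Linearity extends a property of group elements to the middle factor of
    (a b) u (a' b') = a (b u a') b'. *)
Lemma sandwich_span (X Y D : 'M[algC]_#|[set: ST]|) (A B : {set ST}) u :
    (forall x, exists k : algC, X *m gr x *m Y = k *: D) ->
  exists k : algC, X *m (sgn_sum B *m gr u *m row_sum A) *m Y = k *: D.
Proof.
move=> spanD.
have spanZD (k : algC) M M' : (exists k : algC, X *m M *m Y = k *: D) ->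
    (exists k : algC, X *m M' *m Y = k *: D) ->
  exists k' : algC, X *m (k *: M + M') *m Y = k' *: D.
  move=> [k1 e1] [k2 e2]; exists (k * k1 + k2).
  by rewrite mulmxDr mulmxDl -scalemxAr -scalemxAl e1 e2 scalerDl scalerA.
have span0 : exists k : algC, X *m 0 *m Y = k *: D.
  by exists 0; rewrite mulmx0 mul0mx scale0r.
pose spanned M := exists k : algC, X *m M *m Y = k *: D.
rewrite /sgn_sum 2!mulmx_suml; apply: (big_rec spanned) => // q M _ spanM.
rewrite -2!scalemxAl; apply: (spanZD _ _ _ _ spanM).
rewrite /row_sum mulmx_sumr; apply: (big_rec spanned) => // p M' _ spanM'.
by rewrite -[_ *m gr p]scale1r; apply: (spanZD _ _ _ _ spanM'); rewrite -!grM.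
Qed.

End SignedSums.

Section SpechtTheory.

Variable n : nat.
Local Notation gr := (regular_repr algC [set: 'S_n]).
Local Notation N := (#|[set: 'S_n]|%:R : algC).
Implicit Types (la mu : seq nat).

Lemma row_stab_group_set la : group_set (row_stab n la).
Proof.
apply/group_setP; split=> [|s t]; first by rewrite inE; apply/forallP=> i;
  rewrite perm1.
rewrite !inE => /forallP sP /forallP tP; apply/forallP=> i.
by rewrite permM (eqP (tP _)) sP.
Qed.
Canonical row_stab_group la := Group (row_stab_group_set la).

Lemma col_stab_group_set la : group_set (col_stab n la).
Proof.
apply/group_setP; split=> [|s t]; first by rewrite inE; apply/forallP=> i;
  rewrite perm1.
rewrite !inE => /forallP sP /forallP tP; apply/forallP=> i.
by rewrite permM (eqP (tP _)) sP.
Qed.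
Canonical col_stab_group la := Group (col_stab_group_set la).

Local Notation a_ la := (row_sum (row_stab n la)).
Local Notation b_ la := (sgn_sum (col_stab n la)).

Lemma specht_charE la : specht_char n la = cyclic_char (a_ la *m b_ la).
Proof. by rewrite young_sum2. Qed.

Lemma row_col_stabI la : row_stab n la :&: col_stab n la = 1%g.
Proof.
apply/trivgP/subsetP=> s; rewrite !inE => /andP[/forallP rs /forallP cs].
apply/eqP/permP=> i; rewrite perm1; apply: val_inj.
exact: reshape_inj (eqP (rs i)) (eqP (cs i)).
Qed.

Lemma tperm_stab (f : nat -> nat) (i j : 'I_n) : f i = f j ->
  tperm i j \in [set s : 'S_n | [forall k, f (s k) == f k]].
Proof. by move=> eq_f; rewrite inE; apply/forallP=> k;
  case: tpermP => [->|->|_ _]; rewrite ?eq_f. Qed.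

(** Young's dichotomy: if some pair in a common row of la is sent by x to a
    common column of mu, a transposition kills a x b; otherwise the inequality
    on column sums forces la = mu and x = p q, so that a x b = +- a b. *)
Lemma row_gr_col la mu x :
    is_intpart n la -> is_intpart n mu ->
    (\sum_(i < n) reshape_offset mu i <= \sum_(i < n) reshape_offset la i)%N ->
  exists k : algC,
    a_ la *m gr x *m b_ mu = k *: (if la == mu then a_ la *m b_ la else 0).
Proof.
move=> laP muP le_sum.
pose bad (ij : 'I_n * 'I_n) := [&& ij.1 != ij.2,
  reshape_index la ij.1 == reshape_index la ij.2 &
  reshape_offset mu (x ij.1) == reshape_offset mu (x ij.2)].
have [[i j] /and3P[/= neq_ij /eqP eq_r /eqP eq_c] | noBad] := pickP bad.
  exists 0; rewrite scale0r; apply: (@row_gr_sgn_eq0 _ _ _ _ (tperm i j)).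
  - exact: tperm_stab.
  - by rewrite tpermJ; exact: tperm_stab.
  - by rewrite odd_tperm.
have indep (i j : 'I_n) : reshape_index la i = reshape_index la j ->
  reshape_offset mu (x i) = reshape_offset mu (x j) -> i = j.
  move=> eq_r eq_c; have := noBad (i, j);
    rewrite /bad /= eq_r eq_c !eqxx !andbT.
  by move/negbFE/eqP.
have eq_la := indep_shape_eq laP muP indep le_sum;
  rewrite -eq_la in indep le_sum *.
rewrite eqxx; have [p Pp pE] := indep_perm laP laP indep le_sum.
have Qq: (p^-1 * x)%g \in col_stab n la.
  rewrite inE; apply/forallP=> j; rewrite permM -pE permKV //.
exists ((-1) ^+ odd_perm (p^-1 * x)%g).
by rewrite -{1}(mulKVg p x) grM mulmxA row_sum_mulr // -mulmxA sgn_sum_mull //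
  scalemxAr.
Qed.

Section OneShape.
Variable la : seq nat.
Hypothesis laP : is_intpart n la.
Local Notation E := (a_ la *m b_ la).

Lemma tr_specht : \tr E = N.
Proof. exact/tr_young/row_col_stabI. Qed.

Lemma specht_primitive u : E *m gr u *m E = N^-1 * \tr (E *m gr u *m E) *: E.
Proof.
have [|k] := @sandwich_span _ (a_ la) (b_ la) E
   (row_stab n la) (col_stab n la) u.
  by move=> x; have := row_gr_col x laP laP (leqnn _); rewrite eqxx.
rewrite !mulmxA -[_ *m a_ la *m b_ la]mulmxA => ->.
by rewrite linearZ /= tr_specht mulrCA mulVf ?mulr1 ?natr_cardT_neq0.
Qed.

(** The c with E ^ 2 = c E, read off from traces. *)
Definition specht_scalar := N^-1 * \tr (E *m E).

Lemma specht_idem : E *m E = specht_scalar *: E.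
Proof. by have := specht_primitive 1%g; rewrite gr1 mulmx1. Qed.

Lemma specht_scalar_neq0 : specht_scalar != 0.
Proof. by apply: quasi_idem_scalar_neq0 specht_idem _;
  rewrite tr_specht natr_cardT_neq0. Qed.

Lemma specht_class_trace g :
  N * specht_scalar * specht_char n la g = class_trace g E.
Proof.
rewrite specht_charE young_gsum; apply: cyclic_char_idem; rewrite -?young_gsum.
  exact: specht_scalar_neq0.
exact: specht_idem.
Qed.

Lemma specht_norm1 : '[specht_char n la] = 1.
Proof.
rewrite specht_charE young_gsum; apply: cyclic_char_norm1; rewrite -young_gsum.
- exact: specht_idem.
- exact: tr_specht.
- exact: specht_primitive.
Qed.

Lemma specht_irr : specht_char n la \in irr [set: 'S_n].
Proof. by rewrite irrEchar specht_norm1 eqxx cfRepr_char. Qed.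

(** Both the class trace and the scalar [specht_scalar] are combinations of
    integer coefficients. *)
Lemma specht_real g : specht_char n la g \is Num.real.
Proof.
have real_tr u : \tr (E *m gr u) \is Num.real.
  rewrite young_gsum -[u]invgK tr_gsum.
  by rewrite rpredM ?young_coef_real ?realn.
have nzNc: N * specht_scalar != 0.
  by rewrite mulf_neq0 ?natr_cardT_neq0 ?specht_scalar_neq0.
rewrite -(mulKf nzNc (specht_char n la g)) specht_class_trace class_traceE.
have trEE : \tr (E *m E) \is Num.real.
  rewrite -[E *m E]mulmx1 {2}young_gsum tr_mul_gsum rpred_sum // => u _.
  by rewrite mulmx1 rpredM ?young_coef_real ?real_tr.
apply: rpredM; last by apply: rpred_sum => u _; exact: real_tr.
by rewrite rpredV rpredM ?realn // /specht_scalar rpredM // rpredV realn.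
Qed.

End OneShape.

(** The scalar product being hermitian, the two shapes may be ordered by their
    column sums. *)
Lemma specht_orthogonal la mu : is_intpart n la -> is_intpart n mu ->
  la != mu -> '[specht_char n la, specht_char n mu] = 0.
Proof.
move=> laP muP neq; wlog le_sum: la mu laP muP neq /
  (\sum_(i < n) reshape_offset mu i <= \sum_(i < n) reshape_offset la i)%N.
  move=> IH; case/orP: (leq_total (\sum_(i < n) reshape_offset mu i)
    (\sum_(i < n) reshape_offset la i)) => le_sum; first exact: IH.
  by rewrite cfdotC IH ?conjC0 // eq_sym.
rewrite !specht_charE !young_gsum.
apply: (cyclic_char_orthogonal (specht_scalar_neq0 laP)
  (specht_scalar_neq0 muP));
  rewrite -?young_gsum ?specht_idem // => u.
have [|k] := @sandwich_span _ (a_ la) (b_ mu) 0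
   (row_stab n mu) (col_stab n la) u.
  by move=> x; have := row_gr_col x laP muP le_sum; rewrite (negPf neq).
by rewrite !mulmxA scaler0.
Qed.

End SpechtTheory.

(** * Symmetrizers of full symmetric subgroups *)

Section SymSums.

Variable T : finType.
Local Notation Sym := (@perm.Sym T).
Local Notation ST := {perm T}.
Local Notation gr := (regular_repr algC [set: ST]).
Local Notation a_ A := (row_sum (Sym A)).
Local Notation b_ B := (sgn_sum (Sym B)).
Implicit Types (A B : {set T}) (s t : ST) (x : T).

Lemma SymP A s : reflect (forall x, x \notin A -> s x = x) (s \in Sym A).
Proof.
rewrite inE; apply: (iffP subsetP) => [sA x | sA x].
  by apply: contraNeq => sx; apply: sA; rewrite inE.
by rewrite inE; apply: contraNT => /sA->.
Qed.

Lemma SymS A B : A \subset B -> Sym A \subset Sym B.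
Proof.
move/subsetP=> sAB; apply/subsetP=> s /SymP sA;
  apply/SymP=> x /(contra (sAB x)).
exact: sA.
Qed.

Lemma tperm_Sym A x y : x \in A -> y \in A -> tperm x y \in Sym A.
Proof.
move=> Ax Ay; apply/SymP=> z Az.
by rewrite tpermD //; apply: contraNneq Az => <-.
Qed.

Lemma Sym_comm A B s t : [disjoint A & B] -> s \in Sym A -> t \in Sym B ->
  (s * t = t * s)%g.
Proof.
move=> dAB; rewrite !inE => sA tB; exact: perm_onC sA tB dAB.
Qed.

(** The transpositions (x i) are coset representatives of Sym A in
    Sym (x |: A), where i is the preimage of x. *)
Lemma big_Sym_setU1 (V : nmodType) A x (F : ST -> V) : x \notin A ->
  \sum_(s in Sym (x |: A)) F s
    = \sum_(i in x |: A) \sum_(s in Sym A) F (tperm x i * s)%g.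
Proof.
move=> Ax; rewrite (partition_big (fun s : ST => s^-1%g x) (mem (x |: A))) /=.
  apply: eq_bigr => i Ai; rewrite [LHS](reindex_inj (mulgI (tperm x i))) /=.
  apply: eq_bigl => s; rewrite -(inj_eq (@perm_inj _ (tperm x i * s)%g)).
  rewrite permKV permM tpermR [X in _ && X]eq_sym.
  rewrite groupMl; last by rewrite tperm_Sym ?setU11.
  apply/andP/idP=> [[/SymP sA /eqP sx] | sA].
    apply/SymP=> y; have [->|yx] := eqVneq y x; first by rewrite sx.
    by move=> yA; rewrite sA // !inE negb_or yx.
  have /subsetP sub := SymS (subsetUr [set x] A).
  by rewrite sub // (SymP _ _ sA x Ax) eqxx.
move=> s sA; have: (s^-1 \in Sym (x |: A))%g by rewrite groupV.
by rewrite inE => sVA; rewrite perm_closed ?setU11.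
Qed.

Lemma row_sum_setU1 A x : x \notin A ->
  a_ (x |: A) = (1%:M + \sum_(i in A) gr (tperm x i)) *m a_ A.
Proof.
move=> Ax; rewrite {1}/row_sum big_Sym_setU1 // big_setU1 //= tperm1 mulmxDl.
rewrite mul1mx mulmx_suml; congr (_ + _).
  by apply: eq_bigr => s _; rewrite mul1g.
apply: eq_bigr => i _; rewrite /row_sum mulmx_sumr.
by apply: eq_bigr => s _; rewrite grM.
Qed.

Lemma sgn_sum_setU1 B x : x \notin B ->
  b_ (x |: B) = (1%:M - \sum_(i in B) gr (tperm x i)) *m b_ B.
Proof.
move=> Bx; rewrite {1}/sgn_sum big_Sym_setU1 // big_setU1 //= tperm1 mulmxBl.
rewrite mul1mx mulmx_suml -sumrN; congr (_ + _).
  by apply: eq_bigr => s _; rewrite mul1g.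
apply: eq_bigr => i Bi; rewrite /sgn_sum mulmx_sumr -sumrN.
have xi : x != i by apply: contraNneq Bx => ->.
apply: eq_bigr => s _; rewrite grM odd_permM odd_tperm xi addTb signrN.
by rewrite scaleNr scalemxAr.
Qed.

Lemma sgn_sum_setU1r B x : x \notin B ->
  b_ (x |: B) = b_ B *m (1%:M - \sum_(i in B) gr (tperm x i)).
Proof.
move=> Bx; rewrite {1}/sgn_sum (reindex_inj invg_inj) /=.
under eq_bigl do rewrite groupV.
rewrite big_Sym_setU1 // big_setU1 //= tperm1 mulmxBr mulmx1 mulmx_sumr -sumrN.
congr (_ + _); rewrite ?/sgn_sum; first rewrite [RHS](reindex_inj invg_inj) /=.
  by apply: eq_big => [s | s _]; rewrite ?groupV ?mul1g.
apply: eq_bigr => i Bi;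
  rewrite mulmx_suml -sumrN [RHS](reindex_inj invg_inj) /=.
have xi : x != i by apply: contraNneq Bx => ->.
apply: eq_big => [s | s _]; rewrite ?groupV // invMg tpermV grM.
rewrite odd_permM odd_tperm xi addbT !odd_permV signrN.
by rewrite scaleNr scalemxAl.
Qed.

Lemma Sym_conj A s : (Sym A :^ s)%g = Sym (s @: A).
Proof.
apply/setP=> t; rewrite mem_conjg; apply/SymP/SymP=> tA x xA.
  have /= := tA (s^-1%g x); rewrite conjgE invgK !permM permKV => tE.
  have /tE : s^-1%g x \notin A.
    by apply: contra xA => /(imset_f s); rewrite permKV.
  by move/(congr1 s); rewrite !permKV.
rewrite conjgE invgK !permM tA ?permK //.
by rewrite mem_imset //; exact: perm_inj.
Qed.

Lemma row_sumJ (A : {set ST}) s : gr s^-1%g *m row_sum A *m gr s =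
  row_sum (A :^ s)%g.
Proof.
rewrite /row_sum mulmx_sumr mulmx_suml [RHS](reindex_inj (conjg_inj s)) /=.
by apply: eq_big => [p | p _]; rewrite ?memJ_conjg // -!grM conjgE mulgA.
Qed.

Lemma sgn_sumJ (A : {set ST}) s : gr s^-1%g *m sgn_sum A *m gr s =
  sgn_sum (A :^ s)%g.
Proof.
rewrite /sgn_sum mulmx_sumr mulmx_suml [RHS](reindex_inj (conjg_inj s)) /=.
apply: eq_big => [p | p _];
  rewrite ?memJ_conjg // odd_permJ -scalemxAr -scalemxAl.
by rewrite -!grM conjgE mulgA.
Qed.

Lemma class_trace_SymJ g A B s t :
  class_trace g (a_ A *m b_ B *m gr t)
    = class_trace g (a_ (s @: A) *m b_ (s @: B) *m gr (t ^ s)%g).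
Proof.
rewrite -(class_traceJ g s) -!Sym_conj -row_sumJ -sgn_sumJ conjgE !grM.
have grVK M : M *m gr s *m gr s^-1%g = M.
  by rewrite -mulmxA -grM mulgV gr1 mulmx1.
by rewrite !mulmxA !grVK.
Qed.

(** Conjugation by the transpositions (i i') and (j j') preserves A and B. *)
Lemma class_trace_tperm_const g A B i j i' j' : [disjoint A & B] ->
    i \in A -> i' \in A -> j \in B -> j' \in B ->
  class_trace g (a_ A *m b_ B *m gr (tperm i j))
    = class_trace g (a_ A *m b_ B *m gr (tperm i' j')).
Proof.
move=> dAB Ai Ai' Bj Bj'.
have fixA t C : t \in Sym C -> t @: C = C by rewrite inE => /im_perm_on.
have fixB t (C D : {set T}) : [disjoint C & D] -> t \in Sym C -> t @: D = D.
  move=> dCD /SymP tC; rewrite -[RHS]imset_id; apply: eq_in_imset => x Dx.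
  by rewrite tC // (disjointFl dCD).
have dBA : [disjoint B & A] by rewrite disjoint_sym.
have neqAB x y : x \in A -> y \in B -> x != y.
  by move=> Ax; apply: contraTneq => <-; rewrite (disjointFr dAB).
rewrite (class_trace_SymJ g A B (tperm i i')) (fixA _ A) ?tperm_Sym //.
rewrite (fixB _ A) ?tperm_Sym // tpermJ tpermL.
rewrite (tpermD (neqAB _ _ Ai Bj) (neqAB _ _ Ai' Bj)).
rewrite (class_trace_SymJ g A B (tperm j j')) (fixA _ B) ?tperm_Sym //.
rewrite (fixB _ B) ?tperm_Sym // tpermJ tpermL.
by rewrite tpermD // eq_sym neqAB.
Qed.

End SymSums.

Section HookSquare.

Variable T : finType.
Local Notation Sym := (@perm.Sym T).
Local Notation ST := {perm T}.
Local Notation gr := (regular_repr algC [set: ST]).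
Local Notation a_ A := (row_sum (Sym A)).
Local Notation b_ B := (sgn_sum (Sym B)).

Lemma sgn_sum_idem (Q : {group ST}) (B : {set ST}) : B \subset Q ->
  sgn_sum B *m sgn_sum Q = #|B|%:R *: sgn_sum Q.
Proof.
move=> /subsetP sBQ; rewrite {1}/sgn_sum mulmx_suml -sum1_card natr_sum
  scaler_suml.
apply: eq_bigr => q /sBQ Qq; rewrite -scalemxAl sgn_sum_mull // scalerA.
by rewrite -signr_addb addbb.
Qed.

Lemma row_sum_idem (P : {group ST}) (A : {set ST}) : A \subset P ->
  row_sum P *m row_sum A = #|A|%:R *: row_sum P.
Proof.
move=> /subsetP sAP; rewrite {2}/row_sum mulmx_sumr -[#|A|]sum1_card natr_sum
  scaler_suml.
by apply: eq_bigr => p /sAP Pp; rewrite row_sum_mulr // scale1r.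
Qed.

Lemma sgn_sum_commute (A B : {set T}) t : [disjoint A & B] -> t \in Sym A ->
  b_ B *m gr t = gr t *m b_ B.
Proof.
move=> dAB At; rewrite /sgn_sum mulmx_suml mulmx_sumr; apply: eq_bigr => s Bs.
by rewrite -scalemxAl -scalemxAr -!grM (Sym_comm dAB At Bs).
Qed.

Lemma row_sgn_sum_commute (A B : {set T}) : [disjoint A & B] ->
  a_ A *m b_ B = b_ B *m a_ A.
Proof.
move=> dAB; rewrite /row_sum mulmx_suml mulmx_sumr; apply: eq_bigr => s As.
by rewrite (sgn_sum_commute dAB As).
Qed.

Variables (x0 : T) (R C : {set T}).
Hypotheses (R0 : x0 \notin R) (C0 : x0 \notin C) (dRC : [disjoint R & C]).
Local Notation P := (x0 |: R).
Local Notation Q := (x0 |: C).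
Local Notation E := (a_ P *m b_ Q).

(** Expand the second row symmetrizer over the transpositions (x0 i), i in R,
    then one column symmetrizer over the (x0 j), j in C. The terms with both
    i and j present vanish since (x0 j)(x0 i) carries the row pair {x0, i} to
    the column pair {j, x0}; the others are multiples of E. *)
Lemma hook_square : E *m E = (#|R|`! * #|C|`! * (#|R| + #|C| + 1))%:R *: E.
Proof.
have disjoint_setU1 (A : {set T}) x (B : {set T}) :
    [disjoint x |: A & B] = (x \notin B) && [disjoint A & B].
  by rewrite -setI_eq0 setIUl setU_eq0 !setI_eq0 disjoints1.
have mulmx_sum_const (X Y K : 'M[algC]_#|[set: ST]|) (F : T -> 'M_#|[set: ST]|)
    (A : {set T}) : (forall j, j \in A -> X *m (F j *m Y) = K) ->
  X *m ((\sum_(j in A) F j) *m Y) = #|A|%:R *: K.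
  move=> XFY; rewrite mulmx_suml mulmx_sumr -[#|A|]sum1_card natr_sum
    scaler_suml.
  by apply: eq_bigr => j /XFY; rewrite scale1r.
have dRQ : [disjoint R & Q].
  by rewrite disjoint_sym disjoint_setU1 R0 disjoint_sym.
have dPC : [disjoint P & C] by rewrite disjoint_setU1 C0.
have t0 i : i \in R -> tperm x0 i \in Sym P.
  by move=> Ri; rewrite tperm_Sym ?setU11 // inE Ri orbT.
have aab : a_ P *m (b_ Q *m a_ R) = #|R|`!%:R *: E.
  rewrite -row_sgn_sum_commute // mulmxA.
  rewrite (row_sum_idem (P := perm.Sym_group P)) ?SymS ?subsetUr //.
  by rewrite perm.card_Sym scalemxAl.
have bb : b_ Q *m b_ Q = #|Q|`!%:R *: b_ Q.
  by rewrite (sgn_sum_idem (Q := perm.Sym_group Q)) // perm.card_Sym.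
have bCb : b_ C *m b_ Q = #|C|`!%:R *: b_ Q.
  rewrite (sgn_sum_idem (Q := perm.Sym_group Q)) ?perm.card_Sym //.
  by rewrite SymS ?subsetUr.
have btb i : i \in R ->
    a_ P *m (b_ Q *m gr (tperm x0 i) *m b_ Q) = #|C|`!%:R *: E.
  move=> Ri; rewrite {1}sgn_sum_setU1 // -[_ *m b_ C *m _]mulmxA.
  rewrite (sgn_sum_commute dPC (t0 i Ri)) -!mulmxA bCb -!scalemxAr.
  congr (_ *: _); rewrite mulmxBl mulmxBr mul1mx mulmxA.
  rewrite (row_sum_mulr (P := perm.Sym_group P)) ?t0 //.
  rewrite (mulmx_sum_const _ _ 0) ?scaler0 ?subr0 // => j Cj.
  have neq0j : x0 != j by apply: contraNneq C0 => ->.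
  have neq0i : x0 != i by apply: contraNneq R0 => ->.
  have neqij : i != j by apply: contraTneq Ri => ->; rewrite (disjointFl dRC).
  rewrite !mulmxA -[a_ P *m _ *m _]mulmxA -grM.
  apply: (@row_gr_sgn_eq0 _ _ _ _ (tperm x0 i)); first exact: t0.
    rewrite tpermJ !permM tpermL [tperm x0 i j]tpermD //.
    rewrite [tperm x0 j i]tpermD 1?[j == i]eq_sym // tpermR.
    by rewrite tperm_Sym ?setU11 // inE Cj orbT.
  by rewrite odd_tperm neq0i.
rewrite mulmxA -[E *m a_ P]mulmxA [X in b_ Q *m X]row_sum_setU1 //.
rewrite -!mulmxA (row_sgn_sum_commute dRQ).
rewrite mulmxDl mul1mx !mulmxDr.
have ->: a_ P *m (b_ Q *m (b_ Q *m a_ R)) = (#|Q|`! * #|R|`!)%:R *: E.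
  by rewrite [b_ Q *m _]mulmxA bb -scalemxAl -scalemxAr aab scalerA natrM.
rewrite (mulmxA (a_ P) (b_ Q))
  (mulmx_sum_const _ _ ((#|C|`! * #|R|`!)%:R *: E)).
  rewrite scalerA -scalerDl -natrM -natrD; congr (_%:R *: _).
  by rewrite cardsU1 C0 add1n factS; ring.
move=> i Ri; transitivity
    (a_ P *m (b_ Q *m gr (tperm x0 i) *m b_ Q) *m a_ R);
      first by rewrite !mulmxA.
rewrite btb //.
by rewrite -scalemxAl -mulmxA aab scalerA -natrM.
Qed.

End HookSquare.

(** * Hook shapes *)

Section HookShapes.

Lemma reshape_index_cons a la i :
  reshape_index (a :: la) i
    = if (i < a)%N then 0%N else (reshape_index la (i - a)).+1.
Proof. by rewrite /reshape_index /= subn_eq0; case: ltnP => // le_ai;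
  rewrite subSn. Qed.

Lemma reshape_nseq1 k i :
  (i < k)%N -> reshape_index (nseq k 1%N) i =
    i /\ reshape_offset (nseq k 1%N) i = 0%N.
Proof.
elim: k i => // k IH [|i] lt_ik;
  first by rewrite reshape_index_cons reshape_offset_cons.
by rewrite reshape_index_cons reshape_offset_cons /= subn1 /=;
  have [-> ->] := IH i lt_ik.
Qed.

Lemma hook_indexE n k (i : 'I_n) : (k < n)%N ->
  reshape_index (hook_part n k) i =
    (if i < n - k then 0 else (i - (n - k)).+1)%N.
Proof.
move=> lt_kn; rewrite reshape_index_cons; case: ltnP => // le_i.
by have [|-> _ //] := @reshape_nseq1 k (i - (n - k)); have := ltn_ord i; lia.
Qed.

Lemma hook_offsetE n k (i : 'I_n) : (k < n)%N ->
  reshape_offset (hook_part n k) i = (if i < n - k then i : nat else 0)%N.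
Proof.
move=> lt_kn; rewrite reshape_offset_cons; case: ltnP => // le_i.
by have [|_ -> //] := @reshape_nseq1 k (i - (n - k)); have := ltn_ord i; lia.
Qed.

Lemma hook_intpart n k : (k < n)%N -> is_intpart n (hook_part n k).
Proof.
move=> lt_kn; rewrite /is_intpart /hook_part /= inE negb_or.
have -> : path geq (n - k)%N (nseq k 1%N).
  case: k lt_kn => //= k lt_kn; apply/andP; split; first by rewrite /geq /=;
    lia.
  by elim: k {lt_kn} => //= k ->.
by rewrite mem_nseq andbF sumn_nseq mul1n; apply/and3P; split=> //; lia.
Qed.

Lemma hook_part_inj n k j : hook_part n k = hook_part n j -> k = j.
Proof. by move/(congr1 size) => /= []; rewrite !size_nseq. Qed.

(** This is the form of both stabilizers of a hook tableau: the only boxes that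
    they can move are those of one row or column, the level set of f at c. *)
Lemma level_stab_Sym n (f : 'I_n -> nat) (c : nat) (A : {set 'I_n}) :
    (forall i, (i \in A) = (f i == c)) ->
    (forall i j, f i = f j -> f i != c -> i = j) ->
  [set s : 'S_n | [forall i, f (s i) == f i]] = perm.Sym A.
Proof.
move=> AE f_inj; apply/setP=> s; rewrite inE;
  apply/forallP/SymP=> [sf i | sA i].
  by rewrite AE => fi; apply/esym/f_inj; rewrite // (eqP (sf i)).
have [Ai | A'i] := boolP (i \in A); last by rewrite sA.
have /perm_closed: perm_on A s by have /SymP := sA; rewrite inE.
by move/(_ i); rewrite Ai AE => /eqP->; rewrite AE in Ai; rewrite eq_sym.
Qed.

Variable n' : nat.
Local Notation n := n'.+1.
Local Notation gr := (regular_repr algC [set: 'S_n]).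
Local Notation N := (#|[set: 'S_n]|%:R : algC).
Local Notation a_ A := (row_sum (perm.Sym A)).
Local Notation b_ B := (sgn_sum (perm.Sym B)).

Definition init_seg m := [set i : 'I_n | (i < m)%N].

Lemma card_init_seg m : (m <= n)%N -> #|init_seg m| = m.
Proof.
by move=> le_mn; rewrite -sum1_card (eq_bigl _ _ (in_set _)) (big_ord_narrow
  le_mn) sum1_card card_ord.
Qed.

Local Notation A_ k := (init_seg (n - k)).
Local Notation B_ k := (~: A_ k).

Lemma card_coinit k : (k <= n)%N -> #|B_ k| = k.
Proof. by move=> le_kn; have := cardsC (A_ k);
  rewrite card_init_seg ?card_ord; lia. Qed.

Lemma hook_row_stab k : (k < n)%N ->
  row_stab n (hook_part n k) = perm.Sym (A_ k).
Proof.
move=> lt_kn; apply: (@level_stab_Sym _ _ 0%N) => [i | i j];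
  rewrite !hook_indexE //.
  by rewrite inE; case: ltnP.
by do 2!case: ltnP => ? //; move=> e _; apply: val_inj => /=; lia.
Qed.

Lemma hook_col_stab k : (k < n)%N ->
  col_stab n (hook_part n k) = perm.Sym (ord0 |: B_ k).
Proof.
move=> lt_kn; apply: (@level_stab_Sym _ _ 0%N) => [i | i j];
  rewrite !hook_offsetE //.
  by rewrite !inE -leqNgt -(inj_eq val_inj) /=; case: ltnP; lia.
by case: ltnP => _; case: ltnP => _ //= e; rewrite ?e ?eqxx // => _;
  apply: val_inj.
Qed.

Definition hook_elt k := a_ (A_ k) *m b_ (ord0 |: B_ k).

Lemma init_segD k : (k < n)%N -> A_ k = ord0 |: (A_ k :\ ord0).
Proof. by move=> lt_kn; rewrite setD1K // inE subn_gt0. Qed.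

Lemma specht_hook_trace k g : (k < n)%N ->
  N * (n * (k`! * (n' - k)`!))%:R * specht_char n (hook_part n k) g
    = class_trace g (hook_elt k).
Proof.
move=> lt_kn; have hP := hook_intpart lt_kn.
have := specht_class_trace hP g;
  rewrite /specht_scalar hook_row_stab // hook_col_stab //.
rewrite -/(hook_elt k) => <-; congr (_ * _ * _).
have trE : \tr (hook_elt k) = N.
  by have := tr_specht n (hook_part n k);
    rewrite hook_row_stab // hook_col_stab.
have -> : hook_elt k *m hook_elt k = (n * (k`! * (n' - k)`!))%:R *: hook_elt k.
  rewrite /hook_elt init_segD // hook_square ?setD11 //.
  - have := card_init_seg (leq_subr k n);
    rewrite (cardsD1 ord0) inE subn_gt0 lt_kn.
    move=> cA; rewrite -init_segD // card_coinit 1?ltnW //.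
    have -> : #|A_ k :\ ord0| = (n' - k)%N by lia.
    by congr (_%:R *: _); rewrite addn1 subnK // mulnC [(k`! * _)%N]mulnC.
  - by rewrite -init_segD // in_setC in_set subn_gt0 lt_kn.
  - by rewrite -init_segD // -setI_eq0 setIDAC setICr set0D.
by rewrite linearZ /= trE mulrCA mulVf ?mulr1 // natr_cardT_neq0.
Qed.

End HookShapes.

(** * A Pieri rule for hooks *)

Section HookPieri.

Variable n' : nat.
Local Notation n := n'.+1.
Local Notation gr := (regular_repr algC [set: 'S_n]).
Local Notation N := (#|[set: 'S_n]|%:R : algC).
Local Notation a_ A := (row_sum (perm.Sym A)).
Local Notation b_ B := (sgn_sum (perm.Sym B)).
Local Notation A_ k := (init_seg n' (n - k)).
Local Notation B_ k := (~: A_ k).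
Local Notation chi k := (specht_char n (hook_part n k)).
Variable g : 'S_n.
Local Notation T := (class_trace g).

(** This quasi-idempotent generates the k-th exterior power of the permutation
    module, which is induced from the character 1 # sgn of S_(n - k) x S_k. *)
Definition wedge_elt k := a_ (A_ k) *m b_ (B_ k).
Local Notation f_ k := (wedge_elt k).

(** The column of the hook is expanded over its corner. *)
Lemma hook_elt_col k : (k < n)%N ->
  T (hook_elt n' k) = T (f_ k) - \sum_(j in B_ k) T (f_ k *m gr (tperm ord0 j)).
Proof.
move=> lt_kn; rewrite /hook_elt sgn_sum_setU1r;
  last by rewrite in_setC inE subn_gt0 lt_kn.
rewrite mulmxA mulmxBr mulmx1 linearB /= -/(f_ k); congr (_ - _).
by move: (f_ k) => f; rewrite mulmx_sumr linear_sum.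
Qed.

(** The row of the hook is expanded over its corner; conjugation by (0 m) then
    moves the corner, which has stayed in the column, to the first box outside
    of the initial segment. *)
Lemma hook_elt_row k (m : 'I_n) : (k < n)%N -> m = (n' - k)%N :> nat ->
  T (hook_elt n' k)
    = T (f_ k.+1) + \sum_(i in A_ k.+1) T (f_ k.+1 *m gr (tperm m i)).
Proof.
move=> lt_kn mE; pose s := tperm ord0 m; pose R := A_ k :\ ord0.
have imE (X : {set 'I_n}) y : (y \in s @: X) = (s y \in X).
  by rewrite -{1}[y](tpermK ord0 m) mem_imset //; exact: perm_inj.
have sR : s @: R = A_ k.+1.
  apply/setP=> y; rewrite imE !inE /s subSS.
  case: tpermP => [->|->|/eqP y0 /eqP ym].
  - by rewrite -!(inj_eq val_inj) /= mE; lia.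
  - by rewrite eqxx mE ltnn.
  - rewrite -!(inj_eq val_inj) /= mE in y0 ym *; lia.
have sB : s @: (ord0 |: B_ k) = B_ k.+1.
  apply/setP=> y; rewrite imE !inE /s subSS.
  case: tpermP => [->|->|/eqP y0 /eqP ym].
  - by rewrite -!(inj_eq val_inj) /= mE; lia.
  - by rewrite eqxx mE ltnn.
  - rewrite -!(inj_eq val_inj) /= mE in y0 ym *; lia.
rewrite /hook_elt {1}init_segD // -/R row_sum_setU1 ?setD11 //.
have fE t : T (a_ R *m b_ (ord0 |: B_ k) *m gr t) = T (f_ k.+1 *m gr (t ^ s)%g).
  by rewrite (class_trace_SymJ g R _ s) sR sB.
have := fE; set M := a_ R *m _ => fM.
rewrite -mulmxA -/M mulmxDl mul1mx linearD /=; congr (_ + _).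
  by have := fM 1%g; rewrite conj1g gr1 !mulmx1.
transitivity (\sum_(i in R) T (M *m gr (tperm ord0 i))).
  clearbody M; rewrite mulmx_suml linear_sum.
  by apply: eq_bigr => i _; rewrite [LHS]class_traceC.
rewrite -sR big_imset /=; last by move=> i j _ _; exact: perm_inj.
by apply: eq_bigr => i _; rewrite fM tpermJ tpermL.
Qed.

(** Exterior powers of the permutation module split into two consecutive hooks.
    Write tau for the common class trace of f_k (i j), with i in the row and j
    in the column. The two expansions above say that the class traces of the
    hooks k and k - 1 are T(f_k) - k tau and T(f_k) + (n - k) tau, and tau
    cancels in the combination with weights n - k and k. *)
Lemma hook_pieri k : (k <= n)%N ->
  N * (k`! * (n - k)`!)%:R
     * ((if (k < n)%N then chi k g else 0) + (if k is j.+1 then chi j g else 0))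
  = T (f_ k).
Proof.
(* For k = 0 the hook has one row, with symmetrizer f_0. *)
have [->|k_gt0] := posnP k.
  move=> _; rewrite addr0; have := hook_elt_col (ltn0Sn n').
  rewrite -specht_hook_trace // => E; rewrite -[RHS]subr0.
  rewrite [X in _ - X](_ : 0 = \sum_(j in B_ 0) T (f_ 0 *m gr (tperm ord0 j))).
    rewrite -E; congr (_ * _%:R * _); rewrite !subn0 factS; ring.
  by rewrite big1 // => j; rewrite in_setC inE subn0 ltn_ord.
case: k k_gt0 => // k _ lt_kn; have lt_m : (n' - k < n)%N by lia.
pose m : 'I_n := Ordinal lt_m.
have := @hook_elt_row k m lt_kn erefl.
rewrite -specht_hook_trace //.
(* For k + 1 = n the hook has one column, with antisymmetrizer f_n. *)
have [->|neq_k] := eqVneq k n'.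
  rewrite ltnn add0r big1 ?addr0 => [<-|i]; last by rewrite inE subnn.
  by congr (_ * _%:R * _); rewrite !subnn factS; ring.
have lt_k1n : (k.+1 < n)%N by lia.
rewrite lt_k1n => E1; have := hook_elt_col lt_k1n;
  rewrite -specht_hook_trace // => E2.
pose tau := T (f_ k.+1 *m gr (tperm ord0 m)).
have A0 : ord0 \in A_ k.+1 by rewrite inE subn_gt0.
have Bm : m \in B_ k.+1 by rewrite in_setC inE subSS ltnn.
have dAB : [disjoint A_ k.+1 & B_ k.+1] by rewrite -setI_eq0 setICr.
have sum1 : \sum_(i in A_ k.+1) T (f_ k.+1 *m gr (tperm m i)) =
  (n' - k)%:R * tau.
  rewrite (eq_bigr (fun _ => tau)) => [|i Ai].
    by rewrite sumr_const card_init_seg ?leq_subr // subSS [RHS]mulr_natl.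
  by rewrite tpermC; exact: class_trace_tperm_const.
have sum2 : \sum_(j in B_ k.+1) T (f_ k.+1 *m gr (tperm ord0 j)) =
  k.+1%:R * tau.
  rewrite (eq_bigr (fun _ => tau)) => [|j Bj].
    by rewrite sumr_const card_coinit // [RHS]mulr_natl.
  exact: class_trace_tperm_const.
rewrite {}sum1 in E1; rewrite {}sum2 in E2.
have nz_n : n%:R != 0 :> algC by rewrite pnatr_eq0.
apply: (mulfI nz_n).
have nE : n%:R = (n' - k)%:R + k.+1%:R :> algC by rewrite -natrD;
  congr (_%:R); lia.
transitivity ((n' - k)%:R * (T (f_ k.+1) - k.+1%:R * tau)
   + k.+1%:R * (T (f_ k.+1) + (n' - k)%:R * tau)); last first.
  by rewrite nE; ring.
rewrite -E1 -E2.
have [p pE] : exists p, (n' - k = p.+1)%N by exists (n' - k).-1; lia.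
have -> : (n' - k.+1 = p)%N by lia.
rewrite subSS pE !factS !natrM; ring.
Qed.

End HookPieri.

(** * Signs of a permutation on its stable sets *)

Section StableSets.

Variable T : finType.
Local Notation ST := {perm T}.
Implicit Types (B C D : {set T}) (y s : ST).

(** Send the i-th element of B to that of B'; the same for the complements. *)
Lemma eq_card_perm B B' : #|B| = #|B'| -> exists s : ST, s @: B = B'.
Proof.
move=> eqB; have eqC : #|~: B| = #|~: B'| by have := cardsC B;
  have := cardsC B'; lia.
pose mv (X Y : {set T}) x := nth x (enum Y) (index x (enum X)).
have mvP (X Y : {set T}) x : #|X| = #|Y| -> x \in X -> mv X Y x \in Y.
  by move=> eqXY Xx; rewrite -mem_enum mem_nth // -cardE -eqXY cardE index_mem
    mem_enum.
have mv_inj (X Y : {set T}) : #|X| = #|Y| -> {in X &, injective (mv X Y)}.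
  move=> eqXY x x' Xx Xx';
    have lt z : z \in X -> (index z (enum X) < size (enum Y))%N.
    by move=> Xz; rewrite -cardE -eqXY cardE index_mem mem_enum.
  rewrite /mv (set_nth_default x') ?lt // => /eqP.
  rewrite nth_uniq ?lt ?enum_uniq // => /eqP /(congr1 (nth x (enum X))).
  by rewrite !nth_index ?mem_enum.
pose f x := if x \in B then mv B B' x else mv (~: B) (~: B') x.
have fB x : (f x \in B') = (x \in B).
  rewrite /f; case: ifP => Bx; first by rewrite mvP.
  by have := mvP _ _ x eqC; rewrite !in_setC Bx => /(_ isT)/negPf.
have f_inj : injective f.
  move=> x x' eqf; have Bxx' : (x \in B) = (x' \in B) by rewrite -fB eqf fB.
  by move: eqf; rewrite /f -Bxx'; case: ifP => Bx; apply: mv_inj;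
     rewrite ?in_setC -?Bxx' ?Bx.
exists (perm f_inj); apply/eqP; rewrite eqEcard card_imset ?eqB ?leqnn ?andbT;
  last exact: perm_inj.
by apply/subsetP=> _ /imsetP[x Bx ->]; rewrite permE fB.
Qed.

Local Notation stab B := ('N(B | 'P))%g.

Lemma stableP B y : reflect (forall x, (y x \in B) = (x \in B)) (y \in stab B).
Proof.
apply: (iffP idP) => [yB x | yB]; first by have := astabs_act x yB.
by rewrite !inE; apply/subsetP=> x Bx; rewrite inE /= apermE yB.
Qed.

(** The diagonal coefficient of y, in the exterior algebra of the permutation
    module, at the product of the basis vectors indexed by B. *)
Definition stable_sign B y : algC :=
  if y \in stab B then (-1) ^+ odd_perm (restr_perm B y) else 0.

Lemma restr_perm_uniq B y r : y \in stab B -> r \in perm.Sym B ->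
  {in B, y =1 r} -> restr_perm B y = r.
Proof.
move=> yB /SymP rB yr; apply/permP=> x; have [Bx | B'x] := boolP (x \in B).
  by rewrite restr_permE // yr.
by rewrite rB // (out_perm (restr_perm_on _ _)).
Qed.

(** A permutation y = p q with p moving only the complement of B and q only B
    must stabilize B and restrict to q there. *)
Lemma young_coef_stable_sign B y :
  young_coef (perm.Sym (~: B)) (perm.Sym B) y = stable_sign B y.
Proof.
have stabM p q : p \in perm.Sym (~: B) -> q \in perm.Sym B ->
    (p * q)%g \in stab B /\ restr_perm B (p * q)%g = q.
  move=> pB qB; have onB : perm_on (~: B) p by rewrite inE in pB.
  have {}pB := SymP _ _ pB; have pE x : x \in B -> p x = x.
    by move=> Bx; rewrite pB // in_setC Bx.
  have pq : (p * q)%g \in stab B.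
    apply/stableP=> x; rewrite permM perm_closed; last by move: qB; rewrite inE.
    by have := perm_closed x onB; rewrite !in_setC => /negb_inj.
  split=> //; apply: restr_perm_uniq => // x Bx; by rewrite permM pE.
rewrite /stable_sign /young_coef; case: ifP => [yB | /negP yB]; last first.
  rewrite big1 // => p Pp; rewrite big1 // => q Qq.
  by case: eqP => // ypq; case: yB; rewrite ypq; case: (stabM p q).
set q0 := restr_perm B y; pose p0 := (y * q0^-1)%g.
have Qq0 : q0 \in perm.Sym B by rewrite inE restr_perm_on.
have Pp0 : p0 \in perm.Sym (~: B).
  apply/SymP=> x; rewrite in_setC negbK => Bx.
  by rewrite permM -[y x](restr_permE yB) // permK.
rewrite (bigD1 p0) //= (bigD1 q0) //= mulgKV eqxx mulr1n !big1 ?addr0 // =>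
  [p | q].
  case/andP=> Pp neq; rewrite big1 // => q Qq; case: eqP => // ypq;
    case/eqP: neq.
  by rewrite /p0 /q0 ypq; case: (stabM p q) => // _ ->; rewrite mulgK.
case/andP=> Qq neq; case: eqP => // ypq; case/eqP: neq.
by rewrite /q0 ypq; case: (stabM p0 q).
Qed.

Lemma restr_permU C D y : [disjoint C & D] -> y \in stab C -> y \in stab D ->
  restr_perm (C :|: D) y = (restr_perm C y * restr_perm D y)%g.
Proof.
move=> dCD yC yD; have onC := restr_perm_on C y; have onD := restr_perm_on D y.
apply: restr_perm_uniq.
- by apply/stableP=> x; rewrite !inE (stableP _ _ yC) (stableP _ _ yD).
- apply: groupM; apply/SymP=> x; rewrite !inE negb_or => /andP[xC xD].
    exact: out_perm onC _.
  exact: out_perm onD _.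
move=> x; rewrite inE permM => /orP[Cx | Dx].
  rewrite [restr_perm C y x]restr_permE // (out_perm onD) //.
  by rewrite (disjointFr dCD) // (stableP _ _ yC).
by rewrite (out_perm onC) ?restr_permE // (disjointFl dCD).
Qed.

Lemma porbit_stable y x : y \in stab (porbit y x).
Proof.
apply/stableP=> z; rewrite ![_ \in porbit y x]porbit_sym.
by have := porbit_perm y 1 z; rewrite expg1 => ->.
Qed.

(** The cycles of the restriction are C itself and the fixed points outside. *)
Lemma odd_restr_cycle y x :
  odd_perm (restr_perm (porbit y x) y) = ~~ odd #|porbit y x|.
Proof.
set C := porbit y x; set r := restr_perm C y.
have yC : y \in stab C := porbit_stable y x.
have rE i z : z \in C -> (r ^+ i)%g z = (y ^+ i)%g z.
  move=> Cz; elim: i => [|i IH]; first by rewrite !expg0.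
  rewrite !expgSr !permM IH restr_permE //.
  by have /stableP-> : (y ^+ i)%g \in stab C by rewrite groupX.
have porbitC z : z \in C -> porbit r z = C.
  move=> Cz; have -> : C = porbit y z by apply/esym/eqP; rewrite eq_porbit_mem.
  apply/setP=> w; apply/porbitP/porbitP=> -[i ->]; exists i; by rewrite rE.
have porbitNC z : z \notin C -> porbit r z = [set z].
  move=> C'z; have rz := out_perm (restr_perm_on C y) C'z.
  apply/setP=> w; rewrite inE; apply/porbitP/eqP=> [[i ->] | ->].
    by rewrite permX_fix.
  by exists 0%N; rewrite expg0 perm1.
have Cx : x \in C := porbit_id y x.
have -> : odd_perm r = odd #|T| (+) odd #|porbits r| by [].
have -> : porbits r = C |: [set [set z] | z in ~: C].
  apply/setP=> O; rewrite !inE;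
    apply/imsetP/orP=> [[z _ ->] | [/eqP-> | /imsetP[z]]].
  - have [Cz | C'z] := boolP (z \in C); first by rewrite porbitC //; left.
    by right; rewrite porbitNC // imset_f // inE.
  - by exists x => //; rewrite porbitC.
  - by rewrite inE => C'z ->; exists z => //; rewrite porbitNC.
rewrite cardsU1 card_imset; last exact: set1_inj.
have -> : C \notin [set [set z] | z in ~: C].
  apply/imsetP=> -[z]; rewrite inE => /negP C'z CE; case: C'z.
  by rewrite CE set11.
have := cardsC C; rewrite -[#|T|]/#|{: T}| => <-.
by rewrite !oddD /=; case: (odd _); case: (odd _).
Qed.

Definition toggle C B := [set z | (z \in B) (+) (z \in C)].

Lemma toggleK C : involutive (toggle C).
Proof. by move=> B; apply/setP=> z; rewrite !inE addbK. Qed.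

(** Adding or removing a cycle of even length multiplies the sign by -1. *)
Lemma stable_sign_toggle y x B : ~~ odd #|porbit y x| ->
  stable_sign (toggle (porbit y x) B) y = - stable_sign B y.
Proof.
set C := porbit y x => evenC; have yC : y \in stab C := porbit_stable y x.
have oddr : odd_perm (restr_perm C y) by rewrite odd_restr_cycle.
have stabt D : y \in stab D -> y \in stab (toggle C D).
  by move/stableP=> yD; apply/stableP=> z; rewrite !inE yD (stableP _ _ yC).
have stab_eq : (y \in stab (toggle C B)) = (y \in stab B).
  by apply/idP/idP=> /stabt //; rewrite toggleK.
rewrite /stable_sign stab_eq; case: ifP => [yB | _]; last by rewrite oppr0.
have signU D : [disjoint C & D] -> y \in stab D ->
    (-1) ^+ odd_perm (restr_perm (C :|: D) y)
      = - (-1) ^+ odd_perm (restr_perm D y) :> algC.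
  by move=> dCD yD; rewrite restr_permU // odd_permM oddr addTb signrN.
have memC z i : ((y ^+ i)%g z \in B) = (z \in B).
  by have /stableP-> : (y ^+ i)%g \in stab B by rewrite groupX.
have [Bx | B'x] := boolP (x \in B).
  have CB z : z \in C -> z \in B by case/porbitP=> i ->; rewrite memC.
  have BE : B = C :|: toggle C B.
    apply/setP=> z; rewrite !inE; have := CB z; case: (z \in C) => [->|_] //=.
    by rewrite addbF.
  rewrite {2}BE signU ?opprK ?stabt // -setI_eq0; apply/eqP/setP=> z.
  by rewrite !inE; have := CB z; case: (z \in C) => [-> |] //=.
have CB z : z \in C -> z \in B = false.
  by case/porbitP=> i ->; rewrite memC; apply: negPf.
have -> : toggle C B = C :|: B.
  by apply/setP=> z; rewrite !inE; have := CB z;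
    case: (z \in C) => [->|_] //=; rewrite addbF.
rewrite signU // -setI_eq0; apply/eqP/setP=> z; rewrite !inE.
by have := CB z; case: (z \in C) => [-> |].
Qed.

(** Otherwise the odd number that is the product of all the cycle lengths would
    be a multiple of the order of y. *)
Lemma even_order_even_cycle y : ~~ odd #[y]%g -> exists x, ~~ odd #|porbit y x|.
Proof.
move=> even_y; apply/existsP; apply: contraR even_y => /existsPn odd_cyc.
pose m := (\prod_x #|porbit y x|)%N.
have ym : (y ^+ m = 1)%g.
  apply/permP=> x; rewrite perm1 /m (bigD1 x) //= expgM permX_fix //.
  by rewrite -[LHS]/((y ^+ #|porbit y x|)%g x) permX iter_porbit.
have: (#[y]%g %| m)%N by rewrite order_dvdn ym.
move/dvdn_odd; apply; rewrite /m.
by apply: (big_ind (fun k => odd k)) => // [a b oa ob | x _];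
  rewrite ?oddM ?oa //; have := odd_cyc x; rewrite negbK.
Qed.

(** The trace of y on the exterior algebra of the permutation module, that is,
    the product over the cycles of y of 1 - (-1)^length. *)
Definition stable_sum y := \sum_(B : {set T}) stable_sign B y.

(** Toggling an even cycle is an involution that reverses the signs. *)
Lemma stable_sum_even y : ~~ odd #[y]%g -> stable_sum y = 0.
Proof.
move=> even_y; have [x evC] := even_order_even_cycle even_y.
have: stable_sum y = - stable_sum y.
  rewrite {1}/stable_sum (reindex_inj (inv_inj (toggleK (porbit y x)))) -sumrN.
  by apply: eq_bigr => B _; rewrite stable_sign_toggle.
by move/eqP; rewrite -addr_eq0 -mulr2n mulrn_eq0 => /eqP.
Qed.

(** An odd power of the restriction is trivial, so the restriction is even. *)
Lemma stable_sign_odd B y : odd #[y]%g -> stable_sign B y = (y \in stab B)%:R.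
Proof.
move=> odd_y; rewrite /stable_sign; case: ifP => // yB.
suff /negPf->: ~~ odd_perm (restr_perm B y) by [].
have odd_permX k (r : ST) : odd_perm (r ^+ k)%g = odd k && odd_perm r.
  by elim: k => [|k IH]; rewrite ?expg0 ?odd_perm1 // expgS odd_permM IH /=;
    case: odd; case: odd_perm.
have := odd_permX #[y]%g (restr_perm B y); rewrite odd_y /= => <-.
by rewrite -(morphX (restr_perm_morphism B) #[y]%g yB) expg_order morph1
  odd_perm1.
Qed.

Lemma square_root_odd (gT : finGroupType) (y : gT) : odd #[y]%g ->
  ((y ^+ 2) ^+ (#[y]./2.+1) = y)%g.
Proof.
move=> odd_y; rewrite -expgM.
have -> : (2 * (#[y]%g./2.+1) = #[y]%g + 1)%N.
  by have := odd_double_half #[y]%g; rewrite odd_y; lia.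
by rewrite expgD expg_order mul1g expg1.
Qed.

(** An element of odd order is a power of its square, so both stabilize the same
    sets. *)
Lemma stable_sum_square y : odd #[y]%g -> stable_sum (y ^+ 2)%g = stable_sum y.
Proof.
move=> odd_y; apply: eq_bigr => B _; rewrite !stable_sign_odd //; last first.
  by rewrite (dvdn_odd (orderXdvd y 2)).
congr (_%:R); congr nat_of_bool; apply/idP/idP=> [y2B | yB]; last exact: groupX.
by rewrite -(square_root_odd odd_y) groupX.
Qed.

Lemma stable_sum_ge0 y : 0 <= stable_sum y.
Proof.
have [odd_y | even_y] := boolP (odd #[y]%g); last by rewrite stable_sum_even.
by apply: sumr_ge0 => B _; rewrite stable_sign_odd ?ler0n.
Qed.

Lemma stable_sum1_gt0 : 0 < stable_sum 1%g.
Proof.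
rewrite /stable_sum (bigD1 set0) //= stable_sign_odd ?order1 // group1.
rewrite ltr_pwDl ?ltr01 // sumr_ge0 // => B _.
by rewrite stable_sign_odd ?order1 ?ler0n.
Qed.

End StableSets.

(** * The hook character *)

Section HookCharacter.

Variable n' : nat.
Local Notation n := n'.+1.
Local Notation gr := (regular_repr algC [set: 'S_n]).
Local Notation N := (#|[set: 'S_n]|%:R : algC).
Local Notation a_ A := (row_sum (perm.Sym A)).
Local Notation b_ B := (sgn_sum (perm.Sym B)).
Local Notation f_ k := (wedge_elt n' k).
Local Notation fB B := (a_ (~: B) *m b_ B).
Implicit Types (g s u : 'S_n) (B : {set 'I_n}).

Lemma perm_imsetC s B : s @: (~: B) = ~: (s @: B).
Proof.
apply/setP=> y; rewrite -{1}[y](permKV s) in_setC.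
rewrite -[in X in _ = ~~ X](permKV s y).
by rewrite !mem_imset ?in_setC //; exact: perm_inj.
Qed.

Lemma fBJ s B : gr s^-1%g *m fB B *m gr s = fB (s @: B).
Proof.
rewrite -perm_imsetC -!Sym_conj -row_sumJ -sgn_sumJ.
have grVK M : M *m gr s *m gr s^-1%g = M.
  by rewrite -mulmxA -grM mulgV gr1 mulmx1.
by rewrite !mulmxA grVK.
Qed.

Lemma tr_fBJ g u B : \tr (fB (u @: B) *m gr (g ^ u)%g) = \tr (fB B *m gr g).
Proof.
rewrite -fBJ [LHS]mxtrace_mulC [RHS]mxtrace_mulC !mulmxA -grM [LHS]mxtrace_mulC.
have ug : (u * (g ^ u * u^-1) = g)%g by rewrite conjgE !mulgA mulgK mulgV mul1g.
by rewrite !mulmxA -grM ug.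
Qed.

(** All sets B of the same size are conjugate. *)
Lemma class_trace_fB g B : class_trace g (fB B) = class_trace g (f_ #|B|).
Proof.
have leBn : (#|B| <= n)%N by rewrite -[X in (_ <= X)%N]card_ord max_card.
have [s sE] : exists s : 'S_n, s @: (~: init_seg n' (n - #|B|)) = B.
  by apply: eq_card_perm; rewrite card_coinit.
by rewrite -[in LHS]sE -fBJ class_traceJ /wedge_elt setCK.
Qed.

Lemma sum_class_trace_fB g :
  \sum_(B : {set 'I_n}) class_trace g (fB B) = N * N * stable_sum g^-1%g.
Proof.
transitivity (\sum_(u : 'S_n) \sum_(B : {set 'I_n}) \tr (fB B *m gr g)).
  under eq_bigr do rewrite class_traceE.
  rewrite exchange_big /=; apply: eq_bigr => u _.
  rewrite (reindex_inj (h := fun B : {set 'I_n} => u @: B)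
    (imset_inj (@perm_inj _ u))) /=.
  by apply: eq_bigr => B _; exact: tr_fBJ.
rewrite sumr_const -[LHS]mulr_natl -mulrA; congr (_%:R * _);
  first by rewrite cardsT.
rewrite mulr_sumr; apply: eq_bigr => B _.
by rewrite young_gsum -{1}[g]invgK tr_gsum young_coef_stable_sign.
Qed.

(** Summed over k, the Pieri rule counts every hook twice. Its factor
    k! (n - k)! is n! divided by the number of sets B of size k, so it is
    absorbed when f_k is replaced by the average of its conjugates, one for each
    B, and the sum over all B remains. The inverse is there because the trace
    against g extracts the coefficient at g^-1. *)
Lemma hook_charE g : hook_char n g *+ 2 = stable_sum g^-1%g.
Proof.
have nzN := natr_cardT_neq0 (perm_of 'I_n).
have NE : N = n`!%:R by rewrite cardsT card_Sn.
apply: (mulfI (mulf_neq0 nzN nzN)); rewrite -sum_class_trace_fB.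
rewrite (partition_big (fun B : {set 'I_n} => inord #|B| : 'I_n.+1)
  (fun=> true)) //=.
transitivity (N * N * \sum_(k < n.+1)
  ((if (k < n)%N then specht_char n (hook_part n k) g else 0)
    + (if k : nat is j.+1 then specht_char n (hook_part n j) g else 0))).
  congr (_ * _); rewrite big_split /= mulr2n /hook_char sum_cfunE.
  congr (_ + _).
    rewrite [RHS]big_ord_recr /= ltnn addr0.
    apply: eq_bigr => k _.
    by rewrite ltn_ord.
  by rewrite [RHS]big_ord_recl /= add0r.
rewrite mulr_sumr; apply: eq_bigr => k _.
have le_kn : (k <= n)%N by rewrite -ltnS ltn_ord.
rewrite (eq_bigr (fun _ => class_trace g (f_ k))) => [|B /eqP<-]; last first.
  rewrite class_trace_fB inordK // ltnS -[X in (_ <= X)%N]card_ord max_card //.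
rewrite (eq_bigl (fun B : {set 'I_n} => #|B| == k)) => [|B]; last first.
  by rewrite -(inj_eq val_inj) /= inordK // ltnS -[X in (_ <= X)%N]card_ord
    max_card.
have cardk : #|[pred B : {set 'I_n} | #|B| == k]| = 'C(n, k).
  have := card_draws ('I_n) k; rewrite card_ord => <-.
  by apply: eq_card => B; rewrite !inE.
rewrite sumr_const cardk -hook_pieri // -[RHS]mulr_natl.
by rewrite {2}NE -(bin_fact le_kn) natrM; ring.
Qed.

End HookCharacter.

(** * Squares against the hook character *)

Lemma hook_char_even n' (g : 'S_n'.+1) : ~~ odd #[g]%g -> hook_char n'.+1 g = 0.
Proof.
move=> even_g; have := hook_charE g; rewrite stable_sum_even ?orderV //.
by move/eqP; rewrite mulrn_eq0 => /eqP.
Qed.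

Lemma hook_char_square n' (g : 'S_n'.+1) :
  odd #[g]%g -> hook_char n'.+1 (g ^+ 2)%g = hook_char n'.+1 g.
Proof.
move=> odd_g; apply: (@pmulrnI _ 2) => //.
by rewrite !hook_charE -expgVn stable_sum_square ?orderV.
Qed.

Lemma hook_char_ge0 n' (g : 'S_n'.+1) : 0 <= hook_char n'.+1 g.
Proof. by rewrite -(pmulrn_lge0 _ (ltn0Sn 1)) hook_charE stable_sum_ge0. Qed.

Lemma hook_char1_gt0 n' : 0 < hook_char n'.+1 1%g.
Proof. by rewrite -(pmulrn_lgt0 _ (ltn0Sn 1)) hook_charE invg1 stable_sum1_gt0.
Qed.

(** Squaring permutes the elements of odd order. *)
Lemma sum_odd_square (gT : finGroupType) (F : gT -> algC) :
  \sum_(g | odd #[g]%g) F (g ^+ 2)%g = \sum_(g | odd #[g]%g) F g.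
Proof.
pose O := [set g : gT | odd #[g]%g].
have sq_inj : {in O &, injective (fun g : gT => (g ^+ 2)%g)}.
  have order2 (g : gT) : odd #[g]%g -> #[(g ^+ 2)%g]%g = #[g]%g.
    by move=> odd_g; rewrite orderXgcd (eqP (_ : coprime _ 2)) ?divn1 //
      coprimen2.
  move=> g k; rewrite !inE => odd_g odd_k eq2.
  rewrite -(square_root_odd odd_g) -(square_root_odd odd_k).
  by rewrite -(order2 g odd_g) -(order2 k odd_k) eq2.
have sqO : (fun g : gT => (g ^+ 2)%g) @: O = O.
  apply/eqP; rewrite eqEcard card_in_imset // leqnn andbT.
  apply/subsetP=> _ /imsetP[g + ->]; rewrite !inE => Og.
  exact: (dvdn_odd (orderXdvd g 2) Og).
transitivity (\sum_(g in O) F (g ^+ 2)%g); first by apply: eq_bigl => g;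
  rewrite inE.
rewrite -(big_imset F sq_inj) sqO; by apply: eq_bigl => g; rewrite inE.
Qed.

Section Main.
Variables (n' : nat).
Local Notation n := n'.+1.
Local Notation h := (hook_char n).

(** The hook character is supported on odd order elements, where it is invariant
    under squaring. *)
Lemma cfdot_square_hook (phi : 'CF([set: 'S_n])) :
  '[cfSquareArg phi, h] = '[phi, h].
Proof.
have hE (psi : 'CF([set: 'S_n])) :
    '[psi, h] = #|[set: 'S_n]|%:R^-1 * \sum_(g | odd #[g]%g) psi g * h g.
  rewrite cfdotTE; congr (_ * _); rewrite [RHS]big_mkcond /=.
  apply: eq_bigr => g _; rewrite conj_Creal ?ger0_real ?hook_char_ge0 //.
  by case: ifP => // /negbT/hook_char_even->; rewrite mulr0.
rewrite !hE; congr (_ * _).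
rewrite -(sum_odd_square (fun g => phi g * h g)); apply: eq_bigr => g odd_g.
by rewrite cfSquareArgE ?inE // hook_char_square.
Qed.

Lemma cfdot_specht_hook la : is_intpart n la ->
  '[specht_char n la, h] = (if is_hook n la then 1 else 0).
Proof.
move=> laP; rewrite /hook_char cfdot_sumr;
  case: ifP => [/existsP[k /eqP laE] | notH].
  rewrite (bigD1 k) //= big1 => [|j neq_jk].
    by rewrite addr0 -laE specht_norm1.
  apply: specht_orthogonal => //; first exact: hook_intpart.
  by apply: contraNneq neq_jk; rewrite laE => /hook_part_inj /val_inj->.
rewrite big1 // => k _; apply: specht_orthogonal => //;
  first exact: hook_intpart.
by apply: contraFneq notH => laE; apply/existsP; exists k; apply/eqP.
Qed.

(** The scalar product is an average of nonnegative reals that do not all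
    vanish, since they are positive at the identity. *)
Lemma cfdot_specht_sq_hook la : is_intpart n la ->
  '[specht_char n la ^+ 2, h] != 0.
Proof.
move=> laP; set chi := specht_char n la.
have chiR g : chi g \is Num.real by exact: specht_real.
have ge0 g : 0 <= chi g ^+ 2 * h g by rewrite mulr_ge0 ?hook_char_ge0
  ?real_exprn_even_ge0.
rewrite cfdotTE mulf_neq0 ?invr_eq0 ?natr_cardT_neq0 // gt_eqF //.
under eq_bigr => g _ do rewrite cfunE -expr2 conj_Creal ?ger0_real
  ?hook_char_ge0 //.
rewrite (bigD1 1%g) //= ltr_pwDl ?sumr_ge0 //.
have chi1 : chi 1%g != 0.
  by rewrite char1_eq0 ?cfRepr_char // -cfnorm_eq0 specht_norm1 // oner_eq0.
by rewrite mulr_gt0 ?hook_char1_gt0 // real_exprn_even_gt0 // chi1.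
Qed.

End Main.

Theorem proposition4p2 (n : nat) (la : seq nat)
    (n_gt0 : (0 < n)%N) (la_part : is_intpart n la) :
  [/\ '[cfSquareArg (specht_char n la), hook_char n]
        = (if is_hook n la then 1 else 0),
      \sum_(k < n) sg n la (hook_part n k)
        - \sum_(k < n) ag n la (hook_part n k)
        = (if is_hook n la then 1 else 0)
    & ~~ is_hook n la ->
      exists k : 'I_n, exists2 i : Iirr [set: 'S_n],
        'chi_i = specht_char n (hook_part n k)
        & i \in irr_constt (cfAlt2 (specht_char n la))].
Proof.
case: n n_gt0 la_part => // n' _ laP; set n := n'.+1;
  set chi := specht_char n la.
have sqE : '[cfSquareArg chi, hook_char n] = (if is_hook n la then 1 else 0).
  by rewrite cfdot_square_hook cfdot_specht_hook.
have sumE : \sum_(k < n) sg n la (hook_part n k) = '[cfSym2 chi, hook_char n].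
  by rewrite /hook_char cfdot_sumr.
have sumA : \sum_(k < n) ag n la (hook_part n k) = '[cfAlt2 chi, hook_char n].
  by rewrite /hook_char cfdot_sumr.
have two : (2%:R : algC) != 0 by rewrite pnatr_eq0.
have diffE : \sum_(k < n) sg n la (hook_part n k)
        - \sum_(k < n) ag n la (hook_part n k) =
          (if is_hook n la then 1 else 0).
  rewrite sumE sumA -sqE /cfSym2 /cfAlt2 !cfdotZl cfdotDl cfdotBl.
  by field.
split=> // notH.
have [k nz_k | ag0] := pickP (fun k : 'I_n => ag n la (hook_part n k) != 0).
  have /irrP[i iE] := specht_irr (hook_intpart (ltn_ord k)).
  by exists k, i; rewrite ?irr_consttE -?iE.
have Alt0 : \sum_(k < n) ag n la (hook_part n k) = 0.
  by rewrite big1 // => k _; apply/eqP/negbFE/ag0.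
move: diffE; rewrite (negPf notH) Alt0 subr0 sumE => Sym0.
move: Alt0; rewrite sumA => Alt0; case/negP: (cfdot_specht_sq_hook laP).
have -> : chi ^+ 2 = cfSym2 chi + cfAlt2 chi.
  rewrite /cfSym2 /cfAlt2 -scalerDr addrACA subrr addr0 -mulr2n -scaler_nat.
  by rewrite scalerA mulVf ?scale1r.
by rewrite cfdotDl Sym0 Alt0 addr0.
Qed.
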